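(* Let $\mathcal G\subset Hol(\mathbf D_{\mathbf q})$ be a family of free holomorphic functions. Then the following statements are equivalent: (i) $\mathcal G$ is locally bounded. (ii) $\mathcal G$ is a normal set.
   Context: Polydomains. Fix $k\in\mathbb N=\{1,2,\dots\}$ and $n_1,\dots,n_k\in\mathbb N$. Hilbert spaces are complex; $A>0$ means that the operator $A$ is positive and invertible. $\mathbb F_{n_i}^+$ is the unital free semigroup on generators $g^i_1,\dots,g^i_{n_i}$ with identity $g^i_0$, and $|\alpha|$ is the length of $\alpha$. For $X_i=(X_{i,1},\dots,X_{i,n_i})\in B(\mathcal H)^{n_i}$ put $X_{i,\alpha}:=X_{i,j_1}\cdots X_{i,j_p}$ if $\alpha=g^i_{j_1}\cdots g^i_{j_p}$, and $X_{i,g_0^i}:=I$. Fix $\mathbf q=(q_1,\dots,q_k)$, where each $q_i=\sum_{\alpha\in\mathbb F_{n_i}^+}a_{i,\alpha}Z_\alpha$ is a positive regular polynomial in $n_i$ noncommuting indeterminates: a finite sum with $a_{i,\alpha}\ge0$, $a_{i,g_0^i}=0$ and $a_{i,g_j^i}>0$ for $j=1,\dots,n_i$. Define $\Phi_{q_i,X_i}(Y):=\sum_\alpha a_{i,\alpha}X_{i,\alpha}YX_{i,\alpha}^*$ for $Y\in B(\mathcal H)$. $B(\mathcal H)^{n_1}\times_c\cdots\times_cB(\mathcal H)^{n_k}$ is the set of $\mathbf X=(X_1,\dots,X_k)\in B(\mathcal H)^{n_1}\times\cdots\times B(\mathcal H)^{n_k}$ such that, for $s\ne t$, every entry of $X_s$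 commutes with every entry of $X_t$. For $\mathbf p\in\{0,1\}^k$ let $\mathbf\Delta^{\mathbf p}_{\mathbf q,\mathbf X}:=(\mathrm{id}-\Phi_{q_1,X_1})^{p_1}\circ\cdots\circ(\mathrm{id}-\Phi_{q_k,X_k})^{p_k}$ and $\mathbf\Delta_{\mathbf q,\mathbf X}:=\mathbf\Delta^{(1,\dots,1)}_{\mathbf q,\mathbf X}$. Set $\mathbf D^-_{\mathbf q}(\mathcal H):=\{\mathbf X\in B(\mathcal H)^{n_1}\times_c\cdots\times_cB(\mathcal H)^{n_k}:\mathbf\Delta^{\mathbf p}_{\mathbf q,\mathbf X}(I)\ge0\text{ for all }\mathbf p\in\{0,1\}^k\}$ and $\mathbf D_{\mathbf q}(\mathcal H):=\{\mathbf X\in\mathbf D^-_{\mathbf q}(\mathcal H):\mathbf\Delta_{\mathbf q,\mathbf X}(I)>0\}$. Universal model. $b_{i,g_0^i}:=1$ and, for $|\alpha|\ge1$, $b_{i,\alpha}:=\sum_{p=1}^{|\alpha|}\sum a_{i,\gamma_1}\cdots a_{i,\gamma_p}$, the inner sum over $\gamma_1,\dots,\gamma_p\in\mathbb F_{n_i}^+$ with $\gamma_1\cdots\gamma_p=\alpha$ and all $|\gamma_l|\ge1$. $F^2(H_{n_i})$ is the full Fock space of $\mathbb C^{n_i}$, with orthonormal basis $\{e^i_\alpha\}_{\alpha\in\mathbb F_{n_i}^+}$, and $W_{i,j}e^i_\alpha:=\sqrt{b_{i,\alpha}/b_{i,g^i_j\alpha}}\,e^i_{g^i_j\alpha}$.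 On $F^2(H_{n_1})\otimes\cdots\otimes F^2(H_{n_k})$ let $\mathbf W_{i,j}:=I\otimes\cdots\otimes W_{i,j}\otimes\cdots\otimes I$ ($W_{i,j}$ in position $i$); $\mathbf W=(\mathbf W_1,\dots,\mathbf W_k)$, $\mathbf W_i=(\mathbf W_{i,1},\dots,\mathbf W_{i,n_i})$, is the universal model. For $0\le r<1$, $r\mathbf W:=\{r\mathbf W_{i,j}\}\in\mathbf D_{\mathbf q}(\bigotimes_iF^2(H_{n_i}))$. Free holomorphic functions. For $\boldsymbol\alpha=(\alpha_1,\dots,\alpha_k)\in\mathbb F_{n_1}^+\times\cdots\times\mathbb F_{n_k}^+$, $\mathbf X_{\boldsymbol\alpha}:=X_{1,\alpha_1}\cdots X_{k,\alpha_k}$. $\Lambda_{\mathbf p}:=\{\boldsymbol\alpha:|\alpha_i|=p_i,\ i=1,\dots,k\}$ for $\mathbf p\in\mathbb Z_+^k$ ($\mathbb Z_+$ the nonnegative integers). $Hol(\mathbf D_{\mathbf q})$ is the set of free holomorphic functions on $\mathbf D_{\mathbf q}$ with scalar coefficients: formal power series $F=\sum c_{(\boldsymbol\alpha)}\mathbf Z_{\boldsymbol\alpha}$, $c_{(\boldsymbol\alpha)}\in\mathbb C$, such that $F(\mathbf X):=\sum_{\mathbf p\in\mathbb Z_+^k}\sum_{\boldsymbol\alpha\in\Lambda_{\mathbf p}}c_{(\boldsymbol\alpha)}\mathbf X_{\boldsymbol\alpha}$ converges in the operator norm (unordered sum over $\mathbf p$) for every $\mathbf X\in\mathbf D_{\mathbf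 q}(\mathcal H)$ and every Hilbert space $\mathcal H$. Normal and locally bounded sets. $\mathcal G\subset Hol(\mathbf D_{\mathbf q})$ is a normal set if each sequence $\{G_m\}_{m=1}^\infty$ in $\mathcal G$ has a subsequence $\{G_{m_l}\}_{l=1}^\infty$ which converges to an element $G\in Hol(\mathbf D_{\mathbf q})$, i.e. for any $r\in[0,1)$, $\|G_{m_l}(r\mathbf W)-G(r\mathbf W)\|\to0$ as $l\to\infty$. $\mathcal G$ is locally bounded if, for any $r\in[0,1)$, there exists $M>0$ such that $\|F(r\mathbf W)\|\le M$ for all $F\in\mathcal G$. *)

(* Defs.v *)
From HB Require Import structures.
From mathcomp Require Import all_boot all_order all_algebra finmap complex.
From mathcomp Require Import all_classical all_reals all_analysis.
From mathcomp Require Import sesquilinear ring lra.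
From mathcomp Require summability.
Set Implicit Arguments.
Unset Strict Implicit.
Unset Printing Implicit Defensive.
Import Order.TTheory GRing.Theory Num.Theory.
Import numFieldNormedType.Exports.
Local Open Scope classical_set_scope.
Local Open Scope ring_scope.
Local Open Scope complex_scope.

#[export] Existing Instance summability.totally_filter.

(* Norms of a normed module over R[i] take their values in R[i]; the inner
   product is linear in its first argument. *)
HB.mixin Record isHilbert (R : realType) H of CompleteNormedModule R[i] H := {
  hdot : {dot H for Num.conj};
  hdot_norm : forall x : H, hdot x x = `|x| ^+ 2
}.
#[short(type="hilbertType")]
HB.structure Definition Hilbert (R : realType) :=
  {H of isHilbert R H & CompleteNormedModule R[i] H}.

(* Unordered sums of real families, used to build the inner product of l2. *)
Section UnorderedSum.
Context {R : realType} {I : choiceType}.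
Implicit Types (x y : I -> R) (z w : I -> R[i]).
Local Notation psum := summability.partial_sum.

Lemma psumE {V : zmodType} (x : I -> V) A :
  psum x A = \sum_(i <- A) x i.
Proof. by rewrite /summability.partial_sum big_seq_fsetE. Qed.

Definition bounded_psum x := exists M, forall A : {fset I}, \sum_(i <- A) x i <= M.

Definition rsum x : R := lim (psum x @ summability.totally).

Lemma ge0_psum_cvg x : (forall i, 0 <= x i) -> bounded_psum x ->
  psum x @ summability.totally --> sup (range (fun A : {fset I} => psum x A)).
Proof.
move=> x0 [M xM]; set S := range _.
have supS : has_sup S.
  split; first by exists (psum x fset0), fset0.
  by exists M => _ [A _ <-]; rewrite psumE.
apply/cvgrPdist_le => e e0.
have [_ [A _ <-] Ae] := @sup_adherent _ S e e0 supS.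
exists A => //= B AB.
have AleB : psum x A <= psum x B.
  rewrite !psumE (big_fsetID _ (mem A) B)/=.
  have -> : [fset i in B | i \in A]%fset = A.
    apply/fsetP => i; rewrite !inE/= andbC; case: (boolP (i \in A)) => //= iA.
    exact: (fsubsetP AB).
  by rewrite lerDl; apply: sumr_ge0.
have Bs : psum x B <= sup S by apply: sup_upper_bound => //; exists B.
by rewrite ger0_norm ?subr_ge0// lerBlDr; lra.
Qed.

Definition abs_summable x := bounded_psum (fun i => `|x i|).

Lemma abs_summable_cvg x : abs_summable x -> cvg (psum x @ summability.totally).
Proof.
move=> [M xM].
have -> : psum x = (fun A => psum (fun i => `|x i|) A - psum (fun i => `|x i| - x i) A).
  by apply/funext => A; rewrite !psumE -sumrB; apply: eq_bigr => i _; rewrite subKr.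
apply: is_cvgB; apply/cvg_ex.
  by eexists; apply: ge0_psum_cvg; [move=> i; exact: normr_ge0|exists M].
eexists; apply: ge0_psum_cvg; first by move=> i; rewrite subr_ge0 ler_norm.
exists (M + M) => A; rewrite sumrB lerD// -sumrN.
by apply: le_trans (xM A); apply: ler_sum => i _; rewrite -normrN ler_norm.
Qed.

Lemma rsum_lin (a b : R) x y : abs_summable x -> abs_summable y ->
  rsum (fun i => a * x i + b * y i) = a * rsum x + b * rsum y.
Proof.
move=> sx sy; apply: cvg_lim => //.
have -> : psum (fun i => a * x i + b * y i) = (fun A => a * psum x A + b * psum y A).
  by apply/funext => A; rewrite !psumE big_split/= !mulr_sumr.
by apply: cvgD; (apply: cvgMr || apply: cvgMl_tmp); exact: abs_summable_cvg.
Qed.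

Lemma rsum_ge0E x : (forall i, 0 <= x i) -> bounded_psum x ->
  (forall A : {fset I}, \sum_(i <- A) x i <= rsum x) /\
  (forall M, (forall A : {fset I}, \sum_(i <- A) x i <= M) -> rsum x <= M).
Proof.
move=> x0 bx; have /cvg_lim xs := ge0_psum_cvg x0 bx.
rewrite /rsum xs//; split => [A|M xM].
  case: bx => M xM; apply: sup_upper_bound; last by exists A => //; rewrite psumE.
  split; first by exists (psum x fset0), fset0.
  by exists M => _ [B _ <-]; rewrite psumE.
apply: ge_sup; first by exists (psum x fset0), fset0.
by move=> _ [B _ <-]; rewrite psumE.
Qed.

End UnorderedSum.

Section SquareSummable.
Context {R : realType} {I : choiceType}.
Local Notation C := R[i].
Local Notation Re := complex.Re.
Local Notation Im := complex.Im.
Implicit Types f g h : I -> C.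

Definition sqabs (z : C) : R := Re z ^+ 2 + Im z ^+ 2.

Definition square_summable f := bounded_psum (fun i => sqabs (f i)).

Definition l2_pred : {pred I -> C} := fun f => `[< square_summable f >].

Lemma sqabs_ge0 z : 0 <= sqabs z.
Proof. by rewrite addr_ge0 ?sqr_ge0. Qed.

Lemma sqabsM z w : sqabs (z * w) = sqabs z * sqabs w.
Proof. by case: z => a b; case: w => c d; rewrite /sqabs/=; ring. Qed.

Lemma sqabsD_le z w : sqabs (z + w) <= 2 * sqabs z + 2 * sqabs w.
Proof.
case: z => a b; case: w => c d; rewrite /sqabs/=.
have := sqr_ge0 (a - c); have := sqr_ge0 (b - d); nra.
Qed.

Lemma sqabsE z : (sqabs z)%:C = `|z| ^+ 2.
Proof. exact: add_Re2_Im2. Qed.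

Lemma l2_pred_submod : submod_closed l2_pred.
Proof.
split=> [|a f g /asboolP[M fM] /asboolP[N gN]]; apply/asboolP.
  by exists 0 => A; rewrite big1// => i _; rewrite /sqabs /= expr0n addr0.
exists (2 * (sqabs a * M) + 2 * N) => A.
apply: (@le_trans _ _ (\sum_(i <- A) (2 * (sqabs a * sqabs (f i)) + 2 * sqabs (g i)))).
  by apply: ler_sum => i _; rewrite (le_trans (sqabsD_le _ _))// sqabsM.
rewrite big_split/= -!mulr_sumr lerD// ler_wpM2l//.
by rewrite ler_wpM2l ?sqabs_ge0.
Qed.

HB.instance Definition _ :=
  GRing.isSubmodClosed.Build C (I -> C) l2_pred l2_pred_submod.

End SquareSummable.

Record l2 (R : realType) (I : choiceType) :=
  L2 { l2val :> I -> R[i]; l2valP : l2val \in l2_pred }.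

Section l2.
Context {R : realType} {I : choiceType}.
Local Notation C := R[i].
Local Notation Re := complex.Re.
Local Notation Im := complex.Im.
Local Notation l2 := (l2 R I).
Implicit Types f g h : l2.

HB.instance Definition _ := [isSub for @l2val R I].
HB.instance Definition _ := [Choice of l2 by <:].
HB.instance Definition _ := [SubChoice_isSubLmodule of l2 by <:].

Lemma l2P f : square_summable f.
Proof. by have /asboolP := l2valP f. Qed.

Lemma l2_eq f g : f =1 g -> f = g.
Proof. by move=> fg; apply/val_inj/funext. Qed.

Lemma l2D f g i : (f + g) i = f i + g i. Proof. by []. Qed.
Lemma l2N f i : (- f) i = - f i. Proof. by []. Qed.
Lemma l2Z (a : C) f i : (a *: f) i = a * f i. Proof. by []. Qed.
Lemma l20 i : (0 : l2) i = 0. Proof. by []. Qed.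

Let mulc_summable f g :
  abs_summable (fun i => Re (f i * (g i)^*)) /\
  abs_summable (fun i => Im (f i * (g i)^*)).
Proof.
have [M fM] := l2P f; have [N gN] := l2P g.
split; exists (M + N) => A; apply: le_trans (lerD (fM A) (gN A));
  rewrite -big_split; apply: ler_sum => i _ /=;
  case: (f i) => a b; case: (g i) => c d; rewrite /sqabs/= ler_norml.
  have := sqr_ge0 (a + c); have := sqr_ge0 (b + d).
  have := sqr_ge0 (a - c); have := sqr_ge0 (b - d).
  have := sqr_ge0 a; have := sqr_ge0 b; have := sqr_ge0 c; have := sqr_ge0 d.
  by move=> *; apply/andP; split; nra.
have := sqr_ge0 (a + d); have := sqr_ge0 (b + c).
have := sqr_ge0 (a - d); have := sqr_ge0 (b - c).
have := sqr_ge0 a; have := sqr_ge0 b; have := sqr_ge0 c; have := sqr_ge0 d.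
by move=> *; apply/andP; split; nra.
Qed.

Definition l2dot f g : C :=
  rsum (fun i => Re (f i * (g i)^*)) +i* rsum (fun i => Im (f i * (g i)^*)).

Let l2dot_linl g a f h : l2dot (a *: f + h) g = a * l2dot f g + l2dot h g.
Proof.
have [fr fi] := mulc_summable f g; have [hr hi] := mulc_summable h g.
rewrite /l2dot; case: a => a b.
have E1 : (fun i => Re (((a +i* b) *: f + h) i * (g i)^*)) = (fun i =>
    1 * (a * Re (f i * (g i)^*) + (- b) * Im (f i * (g i)^*))
    + 1 * Re (h i * (g i)^*)).
  apply/funext => i; rewrite l2D l2Z.
  by case: (f i) => ? ?; case: (g i) => ? ?; case: (h i) => ? ? /=; ring.
have E2 : (fun i => Im (((a +i* b) *: f + h) i * (g i)^*)) = (fun i =>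
    1 * (b * Re (f i * (g i)^*) + a * Im (f i * (g i)^*))
    + 1 * Im (h i * (g i)^*)).
  apply/funext => i; rewrite l2D l2Z.
  by case: (f i) => ? ?; case: (g i) => ? ?; case: (h i) => ? ? /=; ring.
have comb u v (x y : I -> R) : abs_summable x -> abs_summable y ->
    abs_summable (fun i => u * x i + v * y i).
  move=> [M xM] [N yN]; exists (`|u| * M + `|v| * N) => A.
  apply: (@le_trans _ _ (\sum_(i <- A) (`|u| * `|x i| + `|v| * `|y i|))).
    by apply: ler_sum => i _; rewrite (le_trans (ler_normD _ _))// !normrM.
  by rewrite big_split/= -!mulr_sumr lerD// ler_wpM2l.
rewrite E1 E2 !rsum_lin//; do ?exact: comb.
by apply/eqP; rewrite eq_complex/=; apply/andP; split; apply/eqP; ring.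
Qed.

Let l2dotC f g : l2dot f g = (-1) ^+ false * Num.conj (l2dot g f).
Proof.
have [gr gi] := mulc_summable g f.
rewrite expr0 mul1r /l2dot.
have E1 : (fun i => Re (f i * (g i)^*)) = (fun i =>
    1 * Re (g i * (f i)^*) + 0 * Im (g i * (f i)^*)).
  by apply/funext => i; case: (f i) => ? ?; case: (g i) => ? ? /=; ring.
have E2 : (fun i => Im (f i * (g i)^*)) = (fun i =>
    0 * Re (g i * (f i)^*) + (-1) * Im (g i * (f i)^*)).
  by apply/funext => i; case: (f i) => ? ?; case: (g i) => ? ? /=; ring.
rewrite E1 E2 !rsum_lin//.
by apply/eqP; rewrite eq_complex/=; apply/andP; split; apply/eqP; ring.
Qed.

Let l2dot_linr f a g h : l2dot f (a *: g + h) = Num.conj a * l2dot f g + l2dot f h.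
Proof.
rewrite l2dotC l2dot_linl (l2dotC f g) (l2dotC f h) !expr0 !mul1r.
by rewrite rmorphD rmorphM.
Qed.

Definition sqnorm f : R := rsum (fun i => sqabs (f i)).

Lemma l2dotE f : l2dot f f = (sqnorm f)%:C.
Proof.
rewrite /l2dot /sqnorm.
have -> : (fun i => Im (f i * (f i)^*)) = (fun i => 0 * Re (f i * (f i)^*) + 0 * Im (f i * (f i)^*)).
  by apply/funext => i; case: (f i) => ? ? /=; ring.
have [fr fi] := mulc_summable f f.
rewrite rsum_lin// !mul0r addr0; congr (rsum _ +i* _).
by apply/funext => i; rewrite /sqabs; case: (f i) => ? ? /=; ring.
Qed.

Lemma sqnorm_ub f (A : {fset I}) : \sum_(i <- A) sqabs (f i) <= sqnorm f.
Proof. by apply: (rsum_ge0E _ (l2P f)).1 => i; exact: sqabs_ge0. Qed.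

Lemma sqnorm_lub f M :
  (forall A : {fset I}, \sum_(i <- A) sqabs (f i) <= M) -> sqnorm f <= M.
Proof. by apply: (rsum_ge0E _ (l2P f)).2 => i; exact: sqabs_ge0. Qed.

Lemma sqabs_le_sqnorm f i : sqabs (f i) <= sqnorm f.
Proof. by have := sqnorm_ub f [fset i]%fset; rewrite big_seq_fset1. Qed.

Lemma sqnorm_ge0 f : 0 <= sqnorm f.
Proof. by have := sqnorm_ub f fset0; rewrite big_seq_fset0. Qed.

Let l2dot_gt0 f : f != 0 -> 0 < l2dot f f.
Proof.
move=> f0; rewrite l2dotE -[0]/(0%:C) ltcR lt_neqAle sqnorm_ge0 andbT eq_sym.
apply: contra f0 => /eqP f0; apply/eqP/l2_eq => i.
have := sqabs_le_sqnorm f i; rewrite f0 -lecR sqabsE => fi.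
apply/eqP; rewrite -normr_le0 -(@ler_pXn2r _ 2) ?nnegrE//.
by rewrite expr0n.
Qed.

HB.instance Definition _ := @bilinear_isBilinear.Build C l2 l2 C
  *%R (Num.conj \; *%R) l2dot (l2dot_linl, l2dot_linr).
HB.instance Definition _ := isHermitianSesquilinear.Build C l2 false Num.conj
  l2dot l2dotC.
HB.instance Definition _ := isDotProduct.Build C l2 l2dot l2dot_gt0.

End l2.

Section l2_hilbert.
Context {R : realType} {I : choiceType}.
Local Notation C := R[i].
Local Notation Re := complex.Re.
Local Notation Im := complex.Im.
Local Notation l2 := (l2 R I).
Implicit Types f g h : l2.

Let sqnormZ (a : C) f : sqnorm (a *: f) = sqabs a * sqnorm f.
Proof.
apply: complexI; rewrite -l2dotE rmorphM/= -l2dotE sqabsE normCK.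
by rewrite linearZl_LR linearZr_LR/= mulrA.
Qed.

Let sqnorm_eq0 f : sqnorm f = 0 -> f = 0.
Proof.
move=> f0; apply/eqP; have := dnorm_eq0 (l2dot : {dot l2 for Num.conj}) f.
by rewrite /= l2dotE f0 eqxx => <-.
Qed.

Let sqnorm_comb (a b : R) f g : sqnorm (a%:C *: f + b%:C *: g) =
  a ^+ 2 * sqnorm f + 2 * a * b * Re (l2dot f g) + b ^+ 2 * sqnorm g.
Proof.
have cross : l2dot (a%:C *: f) (b%:C *: g) = (a * b)%:C * l2dot f g.
  rewrite linearZl_LR linearZr_LR/= mulrA; congr (_ * _).
  by apply/eqP; rewrite eq_complex/=; apply/andP; split; apply/eqP; ring.
case: (l2dot f g) cross => u v cross; apply: complexI; rewrite -l2dotE.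
rewrite (hnormD (l2dot : {dot l2 for Num.conj}))/= cross !l2dotE !sqnormZ.
apply/eqP; rewrite eq_complex /sqabs/= .
by apply/andP; split; apply/eqP => /=; ring.
Qed.

Let cauchy_schwarz f g : (Re (l2dot f g)) ^+ 2 <= sqnorm f * sqnorm g.
Proof.
have := sqnorm_ge0 g; rewrite le_eqVlt => /predU1P[/esym/sqnorm_eq0 ->|g0].
  by rewrite linear0r/= expr0n/= mulr_ge0// sqnorm_ge0.
rewrite -(ler_pM2l g0) -subr_ge0.
have := sqnorm_ge0 ((sqnorm g)%:C *: f + (- Re (l2dot f g))%:C *: g).
rewrite sqnorm_comb; set B := Re _; set A := sqnorm f; set D := sqnorm g.
by lra.
Qed.

Definition l2norm f : C := (Num.sqrt (sqnorm f))%:C.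

Let l2norm_triangle f g : l2norm (f + g) <= l2norm f + l2norm g.
Proof.
rewrite /l2norm -rmorphD/= lecR.
have s0 h := sqnorm_ge0 h.
rewrite -(@ler_pXn2r _ 2) ?nnegrE ?addr_ge0 ?sqrtr_ge0//.
rewrite sqrrD !sqr_sqrtr//.
have -> : f + g = 1%:C *: f + 1%:C *: g by rewrite !scale1r.
rewrite sqnorm_comb.
have : Re (l2dot f g) <= Num.sqrt (sqnorm f) * Num.sqrt (sqnorm g).
  rewrite (le_trans (ler_norm _))//.
  rewrite -(@ler_pXn2r _ 2) ?nnegrE ?mulr_ge0 ?sqrtr_ge0//.
  by rewrite exprMn !sqr_sqrtr// real_normK ?num_real// cauchy_schwarz.
set B := Re _; set P := _ * Num.sqrt _ => BP; rewrite -mulr_natr; lra.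
Qed.

Let l2normZ (a : C) f : l2norm (a *: f) = `|a| * l2norm f.
Proof. by rewrite /l2norm sqnormZ sqrtrM ?sqabs_ge0// normc_def -rmorphM. Qed.

Let l2norm_eq0 f : l2norm f = 0 -> f = 0.
Proof.
move/complexI => /eqP; rewrite sqrtr_eq0 => f0; apply: sqnorm_eq0.
by apply/eqP; rewrite eq_le f0 sqnorm_ge0.
Qed.

HB.instance Definition _ :=
  Lmodule_isNormed.Build C l2 l2norm_triangle l2normZ l2norm_eq0.

Lemma l2_normE f : `|f| = (Num.sqrt (sqnorm f))%:C. Proof. by []. Qed.

Lemma l2_norm_le f (e : R) : 0 <= e -> (`|f| <= e%:C) = (sqnorm f <= e ^+ 2).
Proof.
move=> e0; rewrite l2_normE lecR -(@ler_pXn2r _ 2) ?nnegrE ?sqrtr_ge0//.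
by rewrite sqr_sqrtr// sqnorm_ge0.
Qed.

Let l2_complete (F : set_system l2) : ProperFilter F -> cauchy F -> cvg F.
Proof.
move=> FF /cauchyP Fc.
have FA (e : R) : 0 < e -> exists2 A, F A &
    forall f g, A f -> A g -> sqnorm (f - g) <= e ^+ 2.
  move=> e0; have : 0 < (e / 2)%:C by rewrite -[0]/(0%:C) ltcR divr_gt0.
  move=> /Fc[h Fh].
  exists (ball h (e / 2)%:C) => // f g; rewrite -ball_normE/= => hf hg.
  rewrite -l2_norm_le; last exact: ltW.
  have -> : f - g = (h - g) - (h - f) by rewrite opprB [RHS]addrC addrA subrK.
  rewrite (le_trans (ler_normB _ _))// [e]splitr rmorphD/=.
  by apply: lerD; exact: ltW.
have Fcoord (phi : C -> R) : (forall z w, phi z - phi w = phi (z - w)) ->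
    (forall z, phi z ^+ 2 <= sqabs z) -> forall i,
    (fun f : l2 => phi (f i)) @ F --> lim ((fun f : l2 => phi (f i)) @ F).
  move=> phiB phiE i; apply: R_complete; apply/cauchy_exP => e e0.
  have [A FA' Ae] := FA (e / 2) (divr_gt0 e0 (ltr0Sn _ _)).
  have [g Ag] := filter_ex FA'; exists (phi (g i)).
  suff : F [set f : l2 | ball (phi (g i)) e (phi (f i))] by [].
  apply: filterS FA' => f Af; rewrite -ball_normE/= phiB.
  apply: (@le_lt_trans _ _ (e / 2)); last by rewrite gtr_pMr// invf_lt1// ltr1n.
  rewrite -(@ler_pXn2r _ 2) ?nnegrE ?divr_ge0 ?(ltW e0)//.
  rewrite real_normK ?num_real// (le_trans (phiE _))//.
  by rewrite (le_trans (sqabs_le_sqnorm (g - f) i))// Ae.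
pose a i := lim ((fun f : l2 => Re (f i)) @ F).
pose b i := lim ((fun f : l2 => Im (f i)) @ F).
have Fa i : (fun f : l2 => Re (f i)) @ F --> a i.
  apply: Fcoord => [[? ?] [? ?]//|z]; by rewrite /sqabs lerDl sqr_ge0.
have Fb i : (fun f : l2 => Im (f i)) @ F --> b i.
  apply: Fcoord => [[? ?] [? ?]//|z]; by rewrite /sqabs lerDr sqr_ge0.
pose c i : C := a i +i* b i.
have cA (e : R) A : F A -> (forall f g, A f -> A g -> sqnorm (f - g) <= e ^+ 2) ->
    forall g, A g -> forall J : {fset I}, \sum_(i <- J) sqabs (c i - g i) <= e ^+ 2.
  move=> FA' Ae g Ag J.
  have lim_i i : (fun f : l2 => sqabs (f i - g i)) @ F --> sqabs (c i - g i).
    have -> : (fun f : l2 => sqabs (f i - g i)) = (fun f : l2 =>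
       (Re (f i) - Re (g i)) * (Re (f i) - Re (g i)) +
       (Im (f i) - Im (g i)) * (Im (f i) - Im (g i))).
      by apply/funext => f; rewrite /sqabs; case: (f i) (g i) => ? ? [? ?].
    have -> : sqabs (c i - g i) =
       (a i - Re (g i)) * (a i - Re (g i)) + (b i - Im (g i)) * (b i - Im (g i)).
      by rewrite /sqabs /c; case: (g i).
    by apply: cvgD; apply: cvgM; apply: cvgB => //; exact: cvg_cst.
  have limJ : (fun f : l2 => \sum_(i <- J) sqabs (f i - g i)) @ F -->
      \sum_(i <- J) sqabs (c i - g i).
    by apply: cvg_big => [|i _]; [exact: add_continuous|exact: lim_i].
  apply: (cvgr_to_le limJ); apply: filterS FA' => f Af /=.
  exact: le_trans (sqnorm_ub (f - g) J) (Ae _ _ Af Ag).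
have cl2 : c \in l2_pred.
  have [A FA' A1] := FA 1 ltr01; have [g Ag] := filter_ex FA'.
  have /= cgJ := cA 1 A FA' A1 g Ag.
  have cg : (fun i => c i - g i) \in @l2_pred R I.
    by apply/asboolP; exists (1 ^+ 2).
  have -> : c = (fun i => c i - g i) + l2val g.
    by apply/funext => i; exact: (esym (subrK (g i) (c i))).
  by apply: rpredD => //; exact: l2valP.
apply/cvg_ex; exists (L2 cl2); apply/cvgrPdist_le => e e0.
have eE : e = (Re e)%:C by rewrite RRe_real// gtr0_real.
have re0 : 0 < Re e by rewrite -ltcR -eE.
have [A FA' Ae] := FA _ re0.
near=> g.
rewrite eE l2_norm_le; last exact: ltW.
apply: sqnorm_lub => J; apply: (cA _ _ FA' Ae).
by near: g.
Unshelve. all: by end_near. Qed.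

HB.instance Definition _ := Uniform_isComplete.Build l2 l2_complete.

Let l2_hdot_norm f : l2dot f f = `|f| ^+ 2.
Proof. by rewrite l2_normE l2dotE -rmorphXn/= sqr_sqrtr// sqnorm_ge0. Qed.

HB.instance Definition _ := isHilbert.Build R l2 l2_hdot_norm.

End l2_hilbert.

Section Operators.
Context {R : realType} {H : hilbertType R}.
Local Notation C := R[i].
Implicit Types S T Y : H -> H.

Definition bounded_op T :=
  linear T /\ exists M : R, forall x, `|T x| <= M%:C * `|x|.

(* The norm is R[i]-valued, hence the real part. *)
Definition opnorm T : R :=
  sup [set complex.Re `|T x| | x in [set x : H | `|x| <= 1]].

(* Made total by choice; a bounded operator has exactly one such S (Riesz). *)
Definition adjoint T : H -> H :=
  xget (fun=> 0) [set S | forall x y, hdot (T x) y = hdot x (S y)].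

Definition positive_op T := bounded_op T /\ forall x, 0 <= hdot (T x) x.

Definition invertible_op T :=
  exists S, [/\ bounded_op S, S \o T = id & T \o S = id].

End Operators.

(* Positive regular polynomials: w ranges over the free semigroup of words in
   n letters, [::] being its identity. *)
Record posreg (R : realType) (n : nat) := PosReg {
  coef :> {fsfun seq 'I_n -> R with 0};
  coef_ge0 : forall w, 0 <= coef w;
  coef_nil : coef [::] = 0;
  coef_gen : forall j, 0 < coef [:: j] }.

Definition multiword k (n : 'I_k -> nat) := {dffun forall i, seq 'I_(n i)}.
HB.instance Definition _ k n := Choice.on (@multiword k n).

Section Polydomain.
Context {R : realType} {H : hilbertType R}.

Definition word_op n (X : 'I_n -> H -> H) (w : seq 'I_n) : H -> H :=
  foldr (fun j T => X j \o T) id w.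

Definition Phi n (q : posreg R n) (X : 'I_n -> H -> H) (Y : H -> H) : H -> H :=
  \sum_(w <- finsupp q) (q w)%:C *: (word_op X w \o Y \o adjoint (word_op X w)).

Context {k : nat} {n : 'I_k -> nat} (q : forall i, posreg R (n i)).
Implicit Types X : forall i, 'I_(n i) -> H -> H.

Definition Delta (p : 'I_k -> bool) X : (H -> H) -> (H -> H) :=
  \big[comp/id]_(i < k) iter (p i) (fun Y => Y - Phi (q i) (X i) Y).

Definition polydomain_closed X :=
  [/\ forall i j, bounded_op (X i j),
      forall s t, s != t -> forall j l, X s j \o X t l = X t l \o X s j
    & forall p, positive_op (Delta p X id)].

Definition polydomain X :=
  [/\ polydomain_closed X, positive_op (Delta xpredT X id)
    & invertible_op (Delta xpredT X id)].

Definition multiword_op X (w : multiword n) : H -> H :=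
  \big[comp/id]_(i < k) word_op (X i) (w i).

End Polydomain.

Section FreeHolomorphic.
Context {R : realType} {k : nat} {n : 'I_k -> nat}.
Implicit Types F : multiword n -> R[i].

Definition multidegree (p : {ffun 'I_k -> nat}) : set (multiword n) :=
  [set w | forall i, size (w i) = p i].

Lemma finite_multidegree p : finite_set (multidegree p).
Proof.
pose f (t : {dffun forall i, (p i).-tuple 'I_(n i)}) : multiword n :=
  [ffun i => tval (t i)].
apply: (@sub_finite_set _ _ (f @` setT)); last exact/finite_image/finite_finset.
move=> w wp.
have wpb i : size (w i) == p i by apply/eqP; exact: wp.
pose t : {dffun forall i, (p i).-tuple 'I_(n i)} := [ffun i => Tuple (wpb i)].
by exists t => //; apply/ffunP => i; rewrite !ffunE.
Qed.

Section Evaluation.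
Context {H : hilbertType R}.
Implicit Types X : forall i, 'I_(n i) -> H -> H.

Definition hom_part F X (p : {ffun 'I_k -> nat}) : H -> H :=
  \sum_(w \in multidegree p) F w *: multiword_op X w.

Definition converges_to F X (T : H -> H) :=
  bounded_op T /\
  opnorm (summability.partial_sum (hom_part F X) A - T)
    @[A --> summability.totally] --> (0 : R).

(* The norm limit is unique when the entries of X are bounded. *)
Definition free_eval F X : H -> H := xget (fun=> 0) [set T | converges_to F X T].

End Evaluation.

Definition Hol (q : forall i, posreg R (n i)) : set (multiword n -> R[i]) :=
  [set F | forall (H : hilbertType R) (X : forall i, 'I_(n i) -> H -> H),
     polydomain q X -> exists T, converges_to F X T].

End FreeHolomorphic.


Section Weights.
Context {R : realType} {n : nat} (q : posreg R n).
Implicit Types w : seq 'I_n.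

(* The ways of writing w as a product of p nonempty words. *)
Definition factorizations w p : set (p.-tuple (seq 'I_n)) :=
  [set g : p.-tuple (seq 'I_n) | flatten g = w /\ forall l, (1 <= size (tnth g l))%N].
Arguments factorizations w p : clear implicits.

Definition weight w : R :=
  if w == [::] then 1 else
  \sum_(1 <= p < (size w).+1)
    \sum_(g \in factorizations w p) \prod_(l < p) q (tnth g l).

Lemma finite_factorizations w p : finite_set (factorizations w p).
Proof.
pose f (sh : p.-tuple 'I_(size w).+1) : p.-tuple (seq 'I_n) :=
  insubd (nseq_tuple p [::]) (reshape (map val sh) w).
apply: (@sub_finite_set _ _ (f @` setT)); last exact: finite_image.
move=> g [gw _].
have szg l : (size (tnth g l) < (size w).+1)%N.
  rewrite ltnS -gw size_flatten /shape sumnE big_map big_tuple.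
  by rewrite (bigD1 l)//= leq_addr.
have shE : map val [tuple Ordinal (szg l) | l < p] = shape g.
  by rewrite /= -map_comp /shape -[in RHS](map_tnth_enum g) -map_comp; apply: eq_map.
exists [tuple Ordinal (szg l) | l < p] => //; apply: val_inj.
by rewrite /f shE -gw flattenK /insubd insubT/= ?size_tuple.
Qed.

Let S w p : R := \sum_(g \in factorizations w p) \prod_(l < p) q (tnth g l).

Let S_ge0 w p : 0 <= S w p.
Proof. by apply: fsumr_ge0 => g _; apply: prodr_ge0 => l _; exact: coef_ge0. Qed.

Let weightE w : weight w = \sum_(p < (size w).+1) S w p.
Proof.
rewrite /weight; case: eqP => [->|w0]; last first.
  rewrite -(big_mkord xpredT (S w)) [RHS]big_ltn//.
  rewrite -[LHS]add0r; congr (_ + _); apply/esym/fsbig1 => g [gw _]; case: w0.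
  by rewrite -gw (tuple0 g).
rewrite big_ord_recl big_ord0 addr0 /S.
rewrite (_ : factorizations [::] 0 = [set [tuple]]).
  by rewrite fsbig_set1 big_ord0.
apply/seteqP; split=> [g _|_ ->]/=; first exact: tuple0.
by split=> // -[].
Qed.

Let S_cons j w p : coef q [:: j] * S w p <= S (j :: w) p.+1.
Proof.
pose f (g : p.-tuple (seq 'I_n)) := [tuple of [:: j] :: g].
have finj : {in factorizations w p &, injective f}.
  by move=> g h _ _ /(congr1 val)/= [] /val_inj.
rewrite /S mulr_fsumr.
rewrite (@eq_fsbigr _ _ _ _ _ (fun g => \prod_(l < p.+1) q (tnth (f g) l))); last first.
  move=> g _; rewrite big_ord_recl; congr (_ * _).
  by apply: eq_bigr => l _; congr (q _); rewrite !(tnth_nth [::]).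
rewrite -(fsbig_image _ f (fun g => \prod_(l < p.+1) q (tnth g l)) finj).
rewrite [leRHS](fsbigID (f @` factorizations w p))/=; last first.
  exact: finite_factorizations.
rewrite (_ : _ `&` _ = f @` factorizations w p); last first.
  apply/setIidr => _ [g [gw gl] <-]; split=> [|l]; first by rewrite /= gw.
  by case: (unliftP ord0 l) => [m|] ->; rewrite (tnth_nth [::])//= -tnth_nth.
rewrite lerDl; apply: fsumr_ge0 => g _.
by apply: prodr_ge0 => l _; exact: coef_ge0.
Qed.

Lemma weight_cons j w : coef q [:: j] * weight w <= weight (j :: w).
Proof.
rewrite !weightE mulr_sumr [leRHS]big_ord_recl -[leLHS]add0r lerD ?S_ge0//.
by apply: ler_sum => p _; exact: S_cons.
Qed.

Lemma weight_gt0 w : 0 < weight w.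
Proof.
elim: w => [|j w IHw]; first by rewrite /weight eqxx.
by apply: lt_le_trans (weight_cons j w); rewrite mulr_gt0// coef_gen.
Qed.

End Weights.

Section PartialShift.
Context {R : realType} {I J : choiceType}.

Lemma sum_partial_inj (tau : I -> option J) (x : J -> R) (M : R) :
  (forall i i' j, tau i = Some j -> tau i' = Some j -> i = i') ->
  (forall A : {fset J}, \sum_(j <- A) x j <= M) ->
  forall A : {fset I}, \sum_(i <- A) oapp x 0 (tau i) <= M.
Proof.
move=> tauI xM A; rewrite -(big_pmap tau).
have : uniq (pmap tau A).
  elim: (enum_fset A) (fset_uniq A) => //= i s IHs /andP[iNs /IHs us].
  case E : (tau i) => [j|]//=; rewrite us andbT.
  rewrite mem_pmap; apply: contra iNs => /mapP[i' i's E'].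
  by rewrite (tauI _ _ _ E (esym E')).
move: (pmap tau A) => s us; rewrite (le_trans _ (xM [fset j in s]%fset))//.
rewrite (perm_big [fset j in s]%fset)//=; apply: uniq_perm => // j.
by rewrite inE.
Qed.

End PartialShift.

Section DeltaBasis.
Context {R : realType} {I : choiceType}.

Lemma l2delta_mem (i : I) : (fun i' => (i' == i)%:R) \in @l2_pred R I.
Proof.
apply/asboolP; exists 1 => A.
apply: (@le_trans _ _ (\sum_(i' <- A) (i' == i)%:R)).
  by apply: ler_sum => i' _; case: (i' == i); rewrite /sqabs/= !expr2 !mul0r ?mul1r addr0.
rewrite -natr_sum (_ : (\sum_(i' <- A) _)%N = count_mem i A); last first.
  by rewrite -sum1_count [RHS]big_mkcond; apply: eq_bigr => i' _ /=; case: (_ == _).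
by rewrite (count_uniq_mem _ (fset_uniq A)) lern1 leq_b1.
Qed.

Definition l2delta (i : I) : l2 R I := L2 (l2delta_mem i).

End DeltaBasis.


Section FockSpace.
Context {R : realType} {n : nat} (q : posreg R n).
Local Notation fock := (l2 R (seq 'I_n)).
Implicit Types (f : fock) (j : 'I_n) (v w : seq 'I_n).

Definition strip j w : option (seq 'I_n) :=
  if w is h :: v then if h == j then Some v else None else None.

(* The full Fock space of C^n is l2 over the words, e_v being l2delta v; see
   fock_shift_delta for the action of the weighted shift on this basis. *)
Definition shift_fun j f w : R[i] :=
  if strip j w is Some v then
    (Num.sqrt (weight q v / weight q (j :: v)))%:C * f v
  else 0.

Lemma weight_ratio j v : 0 <= weight q v / weight q (j :: v) <= (q [:: j])^-1.
Proof.
apply/andP; split; first by rewrite divr_ge0// ltW// weight_gt0.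
rewrite ler_pdivrMr ?weight_gt0// -ler_pdivrMl ?invr_gt0 ?coef_gen//.
by rewrite invrK weight_cons.
Qed.

Lemma strip_inj j w w' v : strip j w = Some v -> strip j w' = Some v -> w = w'.
Proof.
have E u : strip j u = Some v -> u = j :: v.
  by case: u => //= h t; case: eqP => // -> [->].
by move=> /E -> /E ->.
Qed.

Lemma sqabs_shift j v (z : R[i]) :
  sqabs ((Num.sqrt (weight q v / weight q (j :: v)))%:C * z) <=
  (q [:: j])^-1 * sqabs z.
Proof.
have /andP[r0 r1] := weight_ratio j v.
rewrite sqabsM ler_wpM2r ?sqabs_ge0//.
by rewrite /sqabs/= expr0n addr0 sqr_sqrtr.
Qed.

Lemma shift_bound j f (A : {fset seq 'I_n}) :
  \sum_(w <- A) sqabs (shift_fun j f w) <= (q [:: j])^-1 * sqnorm f.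
Proof.
apply: (@le_trans _ _ (\sum_(w <- A)
    oapp (fun v => (q [:: j])^-1 * sqabs (f v)) 0 (strip j w))).
  apply: ler_sum => w _; rewrite /shift_fun.
  case: strip => [v|]/=; first exact: sqabs_shift.
  by rewrite /sqabs/= expr0n addr0.
apply: sum_partial_inj A => [w w' v|A]; first exact: strip_inj.
by rewrite -mulr_sumr ler_wpM2l ?sqnorm_ub// invr_ge0 ltW// coef_gen.
Qed.

Lemma shift_mem j f : shift_fun j f \in @l2_pred R (seq 'I_n).
Proof. by apply/asboolP; exists ((q [:: j])^-1 * sqnorm f); exact: shift_bound. Qed.

Definition fock_shift j f : fock := L2 (shift_mem j f).

Lemma fock_shift_linear j : linear (fock_shift j).
Proof.
move=> a f g; apply: l2_eq => w; rewrite l2D l2Z /=/shift_fun.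
by case: strip => [v|]; rewrite ?mulr0 ?addr0// l2D l2Z mulrDr mulrCA.
Qed.

Lemma fock_shift_bounded j : bounded_op (fock_shift j).
Proof.
split; first exact: fock_shift_linear.
exists (Num.sqrt (q [:: j])^-1) => f.
have a0 : 0 <= (q [:: j])^-1 by rewrite invr_ge0 ltW// coef_gen.
rewrite !l2_normE -rmorphM/= lecR -sqrtrM//.
by rewrite ler_wsqrtr// sqnorm_lub// => A; exact: shift_bound.
Qed.

Lemma fock_shift_delta j v : fock_shift j (l2delta v) =
  (Num.sqrt (weight q v / weight q (j :: v)))%:C *: l2delta (j :: v).
Proof.
apply: l2_eq => w; rewrite l2Z /= /shift_fun.
case E : (strip j w) => [u|]; last first.
  case: eqP => [wE|_]; last by rewrite mulr0.
  by move: E; rewrite wE /= eqxx.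
have -> : (w == j :: v) = (u == v).
  case: w E => //= h t; case: eqP => // -> [->].
  by rewrite eqseq_cons eqxx.
by rewrite /=; case: eqP => [->|_] //; rewrite !mulr0.
Qed.

End FockSpace.

Section UniversalModel.
Context {R : realType} {k : nat} {n : 'I_k -> nat} (q : forall i, posreg R (n i)).
Local Notation fock i := (l2 R (seq 'I_(n i))).
Local Notation tensor := (l2 R (multiword n)).
Implicit Types (f : tensor) (b w : multiword n) (x : forall i, fock i).

(* The Hilbert tensor product of the Fock spaces is l2 over the multiwords, the
   basis vector e_(w 0) (x) ... (x) e_(w k.-1) being l2delta w (tens_delta). *)
Definition subst_word b i (v : seq 'I_(n i)) : multiword n :=
  [ffun l => dfwith (fun l => b l) i v l].

Lemma subst_word_in b i (v : seq 'I_(n i)) : subst_word b v i = v.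
Proof. by rewrite ffunE dfwithin. Qed.

Lemma subst_word_out b i (v : seq 'I_(n i)) l : i != l -> subst_word b v l = b l.
Proof. by move=> il; rewrite ffunE dfwithout. Qed.

Definition slice_fun f i b (v : seq 'I_(n i)) : R[i] := f (subst_word b v).

Lemma slice_mem f i b : @slice_fun f i b \in l2_pred.
Proof.
apply/asboolP; exists (sqnorm f) => A.
apply: (@sum_partial_inj _ _ _ (fun v => Some (subst_word b v)) (fun w => sqabs (f w))).
  move=> v v' w [<-] [/(congr1 (fun w : multiword n => w i))].
  by rewrite !subst_word_in.
exact: sqnorm_ub.
Qed.

Definition slice f i b : fock i := L2 (slice_mem f i b).

(* I (x) ... (x) W_(i,j) (x) ... (x) I acts by W_(i,j) on the i-th variable;
   model_tens gives its effect on elementary tensors. *)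
Definition model_fun i (j : 'I_(n i)) f b : R[i] :=
  fock_shift (q i) j (slice f i b) (b i).

Lemma model_bound i (j : 'I_(n i)) f (A : {fset multiword n}) :
  \sum_(b <- A) sqabs (model_fun j f b) <= (q i [:: j])^-1 * sqnorm f.
Proof.
apply: (@le_trans _ _ (\sum_(b <- A)
    oapp (fun w => (q i [:: j])^-1 * sqabs (f w)) 0
      (omap (@subst_word b i) (strip j (b i))))).
  apply: ler_sum => b _; rewrite /model_fun /= /shift_fun.
  case: strip => [v|]/=; first exact: sqabs_shift.
  by rewrite /sqabs/= expr0n addr0.
apply: sum_partial_inj A => [b b' w|A]; last first.
  by rewrite -mulr_sumr ler_wpM2l ?sqnorm_ub// invr_ge0 ltW// coef_gen.
case E : (strip j (b i)) => [v|]//= [<-].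
case E' : (strip j (b' i)) => [v'|]//= [vv'].
have eqv : v' = v.
  by have := congr1 (fun w : multiword n => w i) vv'; rewrite !subst_word_in.
apply/ffunP => l; have [<-|il] := eqVneq i l.
  by apply: strip_inj E _; rewrite E' eqv.
have := congr1 (fun w : multiword n => w l) vv'.
by rewrite /= !subst_word_out.
Qed.

Lemma model_mem i (j : 'I_(n i)) f : model_fun j f \in l2_pred.
Proof.
by apply/asboolP; exists ((q i [:: j])^-1 * sqnorm f); exact: model_bound.
Qed.

Definition model i (j : 'I_(n i)) f : tensor := L2 (model_mem j f).

Lemma model_linear i (j : 'I_(n i)) : linear (model j).
Proof.
move=> a f g; apply: l2_eq => b; rewrite l2D l2Z /= /model_fun.
rewrite -[RHS]/((a *: fock_shift (q i) j (slice f i b)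
  + fock_shift (q i) j (slice g i b)) (b i)) -fock_shift_linear.
by congr (l2val (fock_shift _ _ _) _); apply: l2_eq.
Qed.

Lemma model_bounded i (j : 'I_(n i)) : bounded_op (model j).
Proof.
split; first exact: model_linear.
have a0 : 0 <= (q i [:: j])^-1 by rewrite invr_ge0 ltW// coef_gen.
exists (Num.sqrt (q i [:: j])^-1) => f.
rewrite !l2_normE -rmorphM/= lecR -sqrtrM//.
by rewrite ler_wsqrtr// sqnorm_lub// => A; exact: model_bound.
Qed.

Definition tens_fun x w : R[i] := \prod_i x i (w i).

Lemma sum_prod_box (u : forall i, seq 'I_(n i) -> R)
    (K : forall i, {fset seq 'I_(n i)}) (A : {fset multiword n}) :
  (forall i v, 0 <= u i v) -> (forall w i, w \in A -> w i \in K i) ->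
  \sum_(w <- A) \prod_i u i (w i) <= \prod_i \sum_(v <- K i) u i v.
Proof.
move=> u0 AK.
pose T i : finType := K i.
pose P i : {ffun T i -> R} := [ffun v => u i (val v)].
have -> : \prod_i \sum_(v <- K i) u i v = \sum_(t : fprod T) \prod_(i in 'I_k) P i (t i).
  rewrite big_fprod -(bigA_distr_big_dep (fun i => tagged_with T i)
    (fun i g => untag 0 (P i) g)).
  apply: eq_bigr => i _; rewrite -(big_tag (fun i => P i)) big_seq_fsetE.
  by apply: eq_bigr => v _; rewrite ffunE.
pose h (t : fprod T) : multiword n := [ffun i => val (t i)].
have hinj : injective h.
  move=> t t' /ffunP tt'; apply/fprodP => i; apply: val_inj.
  by have := tt' i; rewrite !ffunE.
have -> : \sum_(t : fprod T) \prod_(i in 'I_k) P i (t i) =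
    \sum_(w <- map h (index_enum (fprod T))) \prod_i u i (w i).
  rewrite big_map; apply: eq_bigr => t _.
  by apply: eq_bigr => i _; rewrite !ffunE.
set s := map h _.
have us : uniq s by rewrite map_inj_uniq// index_enum_uniq.
have As w : w \in A -> w \in s.
  move=> wA; apply/mapP.
  exists (fprod_of_fun (fun i => FSetSub (AK _ i wA) : T i)); first exact: mem_index_enum.
  by apply/ffunP => i; rewrite ffunE fprodE.
have pA : perm_eq [seq w <- s | w \in A] A.
  apply: uniq_perm => [||w]; rewrite ?filter_uniq//.
  by rewrite mem_filter; case: (boolP (w \in A)) => //= /As ->.
rewrite [leRHS](bigID (mem A))/= -[X in _ <= X + _]big_filter (perm_big _ pA)/=.
by rewrite lerDl sumr_ge0// => w _; rewrite prodr_ge0.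
Qed.

Lemma tens_mem x : tens_fun x \in l2_pred.
Proof.
apply/asboolP; exists (\prod_i sqnorm (x i)) => A.
have sqabs_prod (w : multiword n) :
    sqabs (tens_fun x w) = \prod_i sqabs (x i (w i)).
  rewrite /tens_fun; elim/big_rec2: _ => [|i y z _ <-]; last by rewrite sqabsM.
  by rewrite /sqabs/= expr0n expr1n addr0.
rewrite (eq_bigr _ (fun w _ => sqabs_prod w)).
pose K i := [fset (w : multiword n) i | w in A]%fset.
rewrite (le_trans (@sum_prod_box (fun i v => sqabs (x i v)) K A _ _))//.
- by move=> i v; exact: sqabs_ge0.
- by move=> w i wA; apply/imfsetP; exists w.
apply: ler_prod => i _; rewrite sqnorm_ub andbT.
by apply: sumr_ge0 => v _; exact: sqabs_ge0.
Qed.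

Definition tens x : tensor := L2 (tens_mem x).

Lemma tens_delta w : tens (fun i => l2delta (w i)) = l2delta w.
Proof.
apply: l2_eq => b; rewrite /= /tens_fun/=.
have [->|/eqP bw] := eqVneq b w; first by rewrite big1// => i _; rewrite eqxx.
have [i bwi] : exists i, b i != w i.
  by apply/not_existsP => h; apply: bw; apply/ffunP => i; apply/eqP/negPn/negP/h.
by rewrite (bigD1 i)//= (negbTE bwi) mul0r.
Qed.

Lemma model_tens i (j : 'I_(n i)) x :
  model j (tens x) = tens (dfwith x i (fock_shift (q i) j (x i))).
Proof.
apply: l2_eq => b; rewrite -[LHS]/(fock_shift (q i) j (slice (tens x) i b) (b i)).
rewrite -[RHS]/(\prod_l dfwith x i (fock_shift (q i) j (x i)) l (b l)).
rewrite [RHS](bigD1 i)// dfwithin.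
have -> : slice (tens x) i b = (\prod_(l | l != i) x l (b l)) *: x i.
  apply: l2_eq => v; rewrite l2Z /= /slice_fun /= /tens_fun (bigD1 i)//=.
  rewrite subst_word_in mulrC; congr (_ * _); apply: eq_bigr => l li.
  by rewrite subst_word_out// eq_sym.
have lin := fock_shift_linear (q i) j (\prod_(l | l != i) x l (b l)) (x i) 0.
have W0 : fock_shift (q i) j 0 = 0.
  by have := fock_shift_linear (q i) j (-1) 0 0; rewrite scaler0 addr0 scaleN1r addNr.
move: lin; rewrite W0 !addr0 => ->.
rewrite l2Z mulrC; congr (_ * _); apply: eq_bigr => l li.
by rewrite dfwithout// eq_sym.
Qed.

Definition scaled_model (r : R) i (j : 'I_(n i)) : tensor -> tensor :=
  r%:C *: model j.

Definition locally_bounded (G : set (multiword n -> R[i])) :=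
  forall r : R, 0 <= r < 1 -> exists2 M : R, 0 < M &
    forall F, G F -> opnorm (free_eval F (scaled_model r)) <= M.

Definition normal_set (G : set (multiword n -> R[i])) :=
  forall g : nat -> multiword n -> R[i], (forall m, G (g m)) ->
  exists2 phi : nat -> nat, {homo phi : l m / (l < m)%N} &
  exists2 F, Hol q F & forall r : R, 0 <= r < 1 ->
    opnorm (free_eval (g (phi l)) (scaled_model r)
            - free_eval F (scaled_model r)) @[l --> \oo] --> (0 : R).

End UniversalModel.

(* Main.v *)
Require Import Defs.
From HB Require Import structures.
From mathcomp Require Import all_boot all_order all_algebra finmap complex.
From mathcomp Require Import all_classical all_reals all_analysis.
From mathcomp Require Import sesquilinear ring lra zify.
From mathcomp Require summability.
Set Implicit Arguments.
Unset Strict Implicit.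
Unset Printing Implicit Defensive.
Import Order.TTheory GRing.Theory Num.Theory.
Import numFieldNormedType.Exports.
Local Open Scope classical_set_scope.
Local Open Scope ring_scope.
Local Open Scope complex_scope.

(** The energy of F in multidegree p is the sum of |c_w|^2 / b_w over the multiwords
    w of multidegree p, where b_w is the product of the weights of the components
    of w. Two estimates reduce the theorem to these numbers.

    Evaluating F at rW and applying the result to the vacuum vector produces the
    coefficients of F, scaled by r^|p| / sqrt b_w, as coordinates. Hence
    r^(2|p|) times the energy is at most the squared norm of F(rW), which is
    energy_le_opnorm, and a locally bounded family has energies which, for every
    s < 1, are at most M s^(-2|p|) with M common to the family.

    Conversely let X be a point of the polydomain on any Hilbert space. Since the
    defect operator is bounded below by some d > 0, each map Phi_i contracts an
    operator Z with d <= Z <= 1 by the factor 1 - d, and the recursion satisfied by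
    the weights turns this into a geometric decay of the sum of b_w X_w X_w^* over
    words of length t. Cauchy-Schwarz then bounds the square of the homogeneous
    part of F at X by C rho^|p| times the energy, with rho < 1
    (polydomain_hom_part), where C and rho depend on X but not on F.

    Consequently, at every point of the polydomain the homogeneous expansions of a
    locally bounded family are dominated by one convergent geometric series. The
    coefficients of a sequence in the family are bounded, so a subsequence converges
    coefficientwise (diagonal_subsequence); the limit inherits the bounds on the
    energies, hence is free holomorphic (energy_growth_converges), and dominated
    convergence gives convergence at rW (dominated_evaluation). That rW belongs to
    the polydomain is scaled_model_polydomain, where everything is diagonal.

    In the other direction, a sequence whose norms at rW tend to infinity has no
    subsequence converging in norm at rW. *)

(** * Finite sums, words and weights *)

Section FiniteSums.
Context {R : realType}.

Lemma ler_sum_uniq (I : eqType) (s1 s2 : seq I) (f : I -> R) :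
  uniq s1 -> {subset s1 <= s2} -> (forall i, 0 <= f i) ->
  \sum_(i <- s1) f i <= \sum_(i <- s2) f i.
Proof.
move=> u1 + f0; elim: s1 u1 s2 => [_ s2 _|i s1 IHs /= /andP[is1 u1] s2 s12].
  by rewrite big_nil sumr_ge0.
have is2 : i \in s2 by apply: s12; rewrite mem_head.
rewrite big_cons (perm_big _ (perm_to_rem is2))/= big_cons lerD2l IHs// => j js1.
have := s12 j; rewrite inE js1 orbT => /(_ isT).
rewrite (perm_mem (perm_to_rem is2)) inE => /predU1P[ji|//].
by rewrite -ji js1 in is1.
Qed.

Lemma sum_CauchySchwarz (I : Type) (s : seq I) (u v : I -> R) :
  (\sum_(i <- s) u i * v i) ^+ 2 <=
  (\sum_(i <- s) u i ^+ 2) * (\sum_(i <- s) v i ^+ 2).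
Proof.
elim: s => [|i s IHs]; first by rewrite !big_nil expr0n mul0r.
rewrite !big_cons.
have : 0 <= \sum_(j <- s) u j ^+ 2 by apply: sumr_ge0 => j _; exact: sqr_ge0.
have : 0 <= \sum_(j <- s) v j ^+ 2 by apply: sumr_ge0 => j _; exact: sqr_ge0.
move: IHs; set S := \sum_(_ <- _) _ * _; set A := \sum_(_ <- _) _; set B := \sum_(_ <- _) _.
move=> SAB B0 A0; have a0 := sqr_ge0 (u i); have b0 := sqr_ge0 (v i).
suff : 2 * S * (u i * v i) <= A * v i ^+ 2 + B * u i ^+ 2 by lra.
have Q0 : 0 <= A * v i ^+ 2 + B * u i ^+ 2 by exact: addr_ge0 (mulr_ge0 A0 b0) (mulr_ge0 B0 a0).
have [P0|/ltW P0] := leP (2 * S * (u i * v i)) 0; first exact: le_trans P0 Q0.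
rewrite -(@ler_pXn2r _ 2) ?nnegrE//.
have := sqr_ge0 (A * v i ^+ 2 - B * u i ^+ 2).
have : 4 * (u i ^+ 2 * v i ^+ 2) * S ^+ 2 <= 4 * (u i ^+ 2 * v i ^+ 2) * (A * B).
  by rewrite ler_wpM2l// mulr_ge0// mulr_ge0.
lra.
Qed.

Lemma bernoulli_le (y : R) d : 0 <= y <= 1 -> 1 - d%:R * y <= (1 - y) ^+ d.
Proof.
move=> /andP[y0 y1]; elim: d => [|d IHd]; first by rewrite mul0r subr0.
have := ler_wpM2l (_ : 0 <= 1 - y) IHd; rewrite subr_ge0 => /(_ y1).
have : 0 <= d%:R * y ^+ 2 by rewrite mulr_ge0// sqr_ge0.
by rewrite [(1 - y) ^+ d.+1]exprS -natr1; lra.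
Qed.

Lemma geometric_sum_le (s : R) N : 0 <= s < 1 ->
  \sum_(m < N) s ^+ m <= (1 - s)^-1.
Proof.
move=> /andP[s0 s1]; have s1' : 0 < 1 - s by rewrite subr_gt0.
rewrite -(ler_pM2l s1') divff ?gt_eqF// -opprB mulNr -subrX1 opprB.
by rewrite lerBlDr lerDl exprn_ge0.
Qed.

Definition total_degree k (p : {ffun 'I_k -> nat}) : nat := (\sum_i p i)%N.

(** The sum over a box of multi-indices factors into one geometric sum per
    coordinate, and every finite set of multi-indices lies in a box. *)
Lemma geometric_multisum_le k (s : R) (A : {fset {ffun 'I_k -> nat}}) :
  0 <= s < 1 -> \sum_(p <- A) s ^+ total_degree p <= ((1 - s)^-1) ^+ k.
Proof.
move=> s01; have /andP[s0 s1] := s01.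
pose N := (\max_(p <- A) total_degree p).+1.
have pN p i : p \in A -> (p i < N)%N.
  move=> pA; rewrite ltnS.
  apply: (@leq_trans (total_degree p)); first by rewrite /total_degree (bigD1 i)//= leq_addr.
  exact: leq_bigmax_seq.
pose h (f : {ffun 'I_k -> 'I_N}) : {ffun 'I_k -> nat} := [ffun i => val (f i)].
have -> : ((1 - s)^-1) ^+ k = \prod_(i < k) (1 - s)^-1 by rewrite big_const_ord iter_mulr_1.
apply: (@le_trans _ _ (\prod_(i < k) \sum_(m < N) s ^+ m)); last first.
  apply: ler_prod => i _; rewrite geometric_sum_le// andbT.
  by apply: sumr_ge0 => m _; rewrite exprn_ge0.
rewrite bigA_distr_bigA/=.
rewrite [leRHS](_ : _ = \sum_(p <- map h (index_enum _)) s ^+ total_degree p); last first.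
  rewrite big_map; apply: eq_bigr => f _.
  by rewrite -expr_sum; congr (_ ^+ _); apply: eq_bigr => i _; rewrite ffunE.
apply: ler_sum_uniq => [|p pA|p]; [exact: fset_uniq| |by rewrite exprn_ge0].
apply/mapP; exists [ffun i => Ordinal (pN p i pA)]; first exact: mem_index_enum.
by apply/ffunP => i; rewrite !ffunE.
Qed.

End FiniteSums.

Section Words.
Context {n : nat}.

Fixpoint words (t : nat) : seq (seq 'I_n) :=
  if t is t'.+1 then [seq j :: v | j <- enum 'I_n, v <- words t'] else [:: [::]].

Lemma mem_words t w : (w \in words t) = (size w == t).
Proof.
elim: t w => [|t IHt] w; first by rewrite inE; case: w.
apply/allpairsP/eqP => [[[j v] [/= _]]|].
  by rewrite IHt => /eqP <- ->.
case: w => //= j v [vt]; exists (j, v); split => //=; first by rewrite mem_enum.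
by rewrite IHt vt.
Qed.

Lemma words_uniq t : uniq (words t).
Proof.
elim: t => //= t IHt; apply: allpairs_uniq => //; first exact: enum_uniq.
by move=> [j v] [h w] _ _ /= [-> ->].
Qed.

Lemma sum_words_cat (R : nmodType) (f : seq 'I_n -> R) s t :
  \sum_(w <- words (s + t)) f w =
  \sum_(u <- words s) \sum_(v <- words t) f (u ++ v).
Proof.
elim: s f => [|s IHs] f; first by rewrite big_seq1.
rewrite addSn /= !big_allpairs_dep; apply: eq_bigr => j _; exact: IHs.
Qed.

End Words.

Section WeightRecursion.
Context {R : realType} {n : nat} (q : posreg R n).
Implicit Types (w u v : seq 'I_n).

(** The factorizations of w into p nonempty words, listed by splitting off the
    first factor: this is the form in which they can be summed recursively. *)
Fixpoint factors w p : seq (seq (seq 'I_n)) :=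
  if p is p'.+1
  then [seq take t w :: g | t <- iota 1 (size w), g <- factors (drop t w) p']
  else if w == [::] then [:: [::]] else [::].

Let mem_factors w p g : (g \in factors w p) =
  [&& size g == p, flatten g == w & all (fun u => u != [::]) g].
Proof.
elim: p w g => [|p IHp] w g /=.
  by case: w => [|j w]; case: g.
apply/allpairsPdep/and3P => [[t [h [+ +]]]|].
  rewrite mem_iota IHp add1n ltnS => /andP[t0 tw] /and3P[/eqP hp /eqP hw ha] ->/=.
  rewrite hp hw cat_take_drop !eqxx ha andbT; split => //.
  by rewrite -size_eq0 size_take_min (minn_idPl tw) -lt0n.
case: g => [|u g] [//= gp /eqP gw /andP[u0 ga]].
exists (size u), g; rewrite mem_iota add1n ltnS IHp -gw take_size_cat// drop_size_cat//.
by rewrite -eqSS gp eqxx ga size_cat leq_addr lt0n size_eq0 u0.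
Qed.

Let factors_uniq w p : uniq (factors w p).
Proof.
elim: p w => [|p IHp] w /=; first by case: eqP.
apply: allpairs_uniq_dep => [|t _|]; [exact: iota_uniq|exact: IHp|].
move=> [t g] [s h] /allpairsPdep[t' [g' [+ _ [-> _]]]].
move=> + /allpairsPdep[s' [h' [+ _ [-> _]]]] /= [+ gh].
rewrite !mem_iota !add1n !ltnS => /andP[_ tw] /andP[_ sw] /(congr1 size).
by rewrite !size_take_min (minn_idPl tw) (minn_idPl sw) gh => ->.
Qed.

Let S w p : R := \sum_(g <- factors w p) \prod_(u <- g) q u.

Let S_S w p :
  S w p.+1 = \sum_(1 <= t < (size w).+1) q (take t w) * S (drop t w) p.
Proof.
rewrite /S /= big_allpairs_dep /index_iota subn1; apply: eq_bigr => t _.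
by rewrite mulr_sumr; apply: eq_bigr => g _; rewrite big_cons.
Qed.

Let S_big w p : (size w < p)%N -> S w p = 0.
Proof.
move=> wp; rewrite /S big_seq big1// => g; rewrite mem_factors => /and3P[/eqP gp /eqP gw ga].
suff : (size g <= size w)%N by rewrite gp leqNgt wp.
rewrite -gw; elim: g ga {gp gw} => //= u g IHg /andP[u0 /IHg gg].
by rewrite size_cat -add1n leq_add// lt0n size_eq0.
Qed.

Let S_0 w : S w 0 = (w == [::])%:R.
Proof. by rewrite /S/=; case: eqP => _; rewrite ?big_seq1 ?big_nil. Qed.

Let factorizationsE w p :
  \sum_(g \in @factorizations n w p) \prod_(l < p) q (tnth g l) = S w p.
Proof.
pose f (s : seq (seq 'I_n)) := \prod_(u <- s) q u.
rewrite (@eq_fsbigr _ _ _ _ _ (f \o val)) => [|g _]; last by rewrite /f /= big_tuple.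
rewrite -(fsbig_image (@factorizations n w p) val f); last by move=> g h _ _ /val_inj.
rewrite /S (fsbig_seq _ _ (factors_uniq w p)); congr (\sum_(i \in _) _).
apply/seteqP; split=> [_ [g [gw gl] <-]|g] /=.
  rewrite mem_factors size_tuple gw !eqxx/=; apply/all_tnthP => l.
  by rewrite -size_eq0 -lt0n gl.
rewrite mem_factors => /and3P[gp /eqP gw /allP ga].
exists (Tuple gp) => //; split => // l; rewrite lt0n size_eq0.
exact: ga (mem_tnth l (Tuple gp)).
Qed.

Let weightE w : weight q w = \sum_(0 <= p < (size w).+1) S w p.
Proof.
rewrite big_ltn// S_0 /weight; case: eqP => [->|_].
  by rewrite big_geq// addr0.
by rewrite add0r; apply: eq_bigr => p _; exact: factorizationsE.
Qed.

Lemma weight_nil : weight q [::] = 1.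
Proof. by rewrite /weight eqxx. Qed.

(** Splitting off the first factor of each factorization of w. Together with
    a_{empty} = 0 this is the identity expressing that the sum of the b_w Z_w is the
    inverse of 1 - q. *)
Lemma weight_rec w : w != [::] ->
  weight q w = \sum_(1 <= t < (size w).+1) q (take t w) * weight q (drop t w).
Proof.
move=> w0; rewrite weightE big_nat_recl// S_0 (negbTE w0) add0r.
under eq_bigr do rewrite S_S.
rewrite exchange_big/=; apply: eq_big_nat => t /andP[t0 tw].
rewrite -mulr_sumr; congr (_ * _); rewrite weightE size_drop.
rewrite [LHS](big_cat_nat (n := (size w - t).+1))//=; last by lia.
rewrite [X in _ + X]big_nat_cond [X in _ + X]big1 ?addr0// => p.
by rewrite andbT => /andP[tp _]; apply: S_big; rewrite size_drop.
Qed.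

End WeightRecursion.

Section WordDecay.
Context {R : realType} {n : nat} (q : posreg R n).

Lemma sum_words_le_coef (h : seq 'I_n -> R) p : (forall u, 0 <= h u) ->
  \sum_(1 <= t < p.+1) \sum_(u <- words t) q u * h u <=
  \sum_(u <- finsupp q) q u * h u.
Proof.
move=> h0; pose s : seq (seq 'I_n) := [seq u | t <- index_iota 1 p.+1, u <- words t].
rewrite (_ : \sum_(1 <= t < p.+1) _ = \sum_(u <- s) q u * h u); last first.
  by rewrite /s big_allpairs_dep.
have us : uniq s.
  apply: allpairs_uniq_dep => [|t _|]; [exact: iota_uniq|exact: words_uniq|].
  move=> [t u] [t' u'] /allpairsPdep[t1 [u1 [_ + [-> ->]]]].
  move=> + /allpairsPdep[t2 [u2 [_ + [-> ->]]]] /= u12.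
  by rewrite !mem_words u12 => /eqP -> /eqP ->.
rewrite (bigID (fun u => u \in finsupp q))/= [X in _ + X]big1 ?addr0; last first.
  by move=> u uq; rewrite fsfun_dflt ?mul0r.
rewrite -big_filter; apply: ler_sum_uniq; first exact: filter_uniq.
  by move=> u; rewrite mem_filter => /andP[].
by move=> u; rewrite mulr_ge0// coef_ge0.
Qed.

(** With A_u the adjoint of X_u and z the quadratic form of an operator Z, the
    hypothesis says Phi(Z) <= rho^d Z and the conclusion that the part of degree p
    of the sum of b_w X_w Z X_w^* is at most rho^p Z. By the recursion for the
    weights, that part is the sum of a_u X_u (part of degree p - |u|) X_u^* over
    the words u; as |u| <= d on the support of q, the induction hypothesis loses at
    most a factor rho^d, which the bound on Phi(Z) restores. *)
Lemma word_decay (H : Type) (A : seq 'I_n -> H -> H) (z : H -> R) (rho : R) (d : nat) :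
  (forall x, A [::] x = x) -> (forall u v x, A (u ++ v) x = A v (A u x)) ->
  (forall x, 0 <= z x) -> 0 < rho <= 1 ->
  (forall u, u \in finsupp q -> (size u <= d)%N) ->
  (forall x, \sum_(u <- finsupp q) q u * z (A u x) <= rho ^+ d * z x) ->
  forall p x, \sum_(w <- words p) weight q w * z (A w x) <= rho ^+ p * z x.
Proof.
move=> A0 AD z0 /andP[r0 r1] qd zA p; elim/ltn_ind: p => -[_|p IHp] x.
  by rewrite big_seq1 weight_nil A0.
apply: (@le_trans _ _ (\sum_(1 <= t < p.+2) \sum_(u <- words t)
    q u * (rho ^+ (p.+1 - t) * z (A u x)))).
  rewrite [leLHS](_ : _ = \sum_(1 <= t < p.+2) \sum_(u <- words t)
    q u * \sum_(v <- words (p.+1 - t)) weight q v * z (A v (A u x))).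
    rewrite big_nat_cond [leRHS]big_nat_cond; apply: ler_sum => t.
    rewrite andbT => /andP[t0 tp]; apply: ler_sum => u _.
    by rewrite ler_wpM2l ?coef_ge0// IHp//; lia.
  transitivity (\sum_(w <- words p.+1) \sum_(1 <= t < p.+2)
      q (take t w) * weight q (drop t w) * z (A (drop t w) (A (take t w) x))).
    rewrite big_seq [RHS]big_seq; apply: eq_bigr => w; rewrite mem_words => /eqP wp.
    rewrite weight_rec -?size_eq0 wp// mulr_suml; apply: eq_bigr => t _.
    by rewrite -AD cat_take_drop.
  rewrite exchange_big; apply: eq_big_nat => t /andP[t0 tp].
  have tp' : (t + (p.+1 - t))%N = p.+1 by rewrite subnKC.
  rewrite -[in LHS]tp' sum_words_cat.
  rewrite big_seq [RHS]big_seq; apply: eq_bigr => u; rewrite mem_words => /eqP ut.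
  rewrite mulr_sumr; apply: eq_bigr => v _.
  by rewrite take_size_cat// drop_size_cat// mulrA.
apply: (@le_trans _ _ (\sum_(1 <= t < p.+2) \sum_(u <- words t)
    q u * (rho ^+ p.+1 / rho ^+ d * z (A u x)))).
  rewrite big_nat_cond [leRHS]big_nat_cond; apply: ler_sum => t.
  rewrite andbT => /andP[t0 tp]; rewrite big_seq [leRHS]big_seq.
  apply: ler_sum => u; rewrite mem_words => /eqP ut.
  have [uq|uq] := boolP (u \in finsupp q); last by rewrite fsfun_dflt// !mul0r.
  rewrite ler_wpM2l ?coef_ge0// ler_wpM2r// ler_pdivlMr ?exprn_gt0// -exprD.
  have td : (t <= d)%N by rewrite -ut qd.
  by rewrite ler_wiXn2l ?(ltW r0)//; lia.
under eq_bigr do under eq_bigr do rewrite mulrCA.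
under eq_bigr do rewrite -mulr_sumr.
rewrite -mulr_sumr (le_trans (ler_wpM2l _ (sum_words_le_coef _ _)))//.
  by rewrite divr_ge0// exprn_ge0// ltW.
rewrite (le_trans (ler_wpM2l _ (zA x)))//; first by rewrite divr_ge0// exprn_ge0// ltW.
by rewrite mulrA divfK// expf_neq0// gt_eqF.
Qed.

End WordDecay.

(** * Hilbert spaces *)

Section RealNorm.
Context {R : realType}.
Local Notation C := R[i].
Local Notation Re := complex.Re.
Local Notation Im := complex.Im.

Definition nrm {V : normedZmodType C} (x : V) : R := Re `|x|.

Lemma ge0_ReK (z : C) : 0 <= z -> z = (Re z)%:C.
Proof. by move=> z0; rewrite RRe_real// ger0_real. Qed.

Lemma ReD (z w : C) : Re (z + w) = Re z + Re w.
Proof. by case: z; case: w. Qed.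

Lemma ReN (z : C) : Re (- z) = - Re z.
Proof. by case: z. Qed.

Lemma ReZ (t : R) (z : C) : Re (t%:C * z) = t * Re z.
Proof. by case: z => a b /=; rewrite mul0r subr0. Qed.

Lemma Re_conj (z : C) : Re (Num.conj z) = Re z.
Proof. by case: z. Qed.

Section NormedZmod.
Context {V : normedZmodType C}.
Implicit Types x y : V.

Lemma nrmE x : `|x| = (nrm x)%:C.
Proof. by apply: ge0_ReK; exact: normr_ge0. Qed.

Lemma nrm_ge0 x : 0 <= nrm x.
Proof. by rewrite -lecR -nrmE normr_ge0. Qed.

Lemma nrm0 : nrm (0 : V) = 0.
Proof. by rewrite /nrm normr0. Qed.

Lemma nrm_eq0 x : nrm x = 0 -> x = 0.
Proof. by move=> x0; apply/eqP; rewrite -normr_eq0 nrmE x0. Qed.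

Lemma nrmD x y : nrm (x + y) <= nrm x + nrm y.
Proof. by rewrite -lecR rmorphD/= -!nrmE ler_normD. Qed.

Lemma nrmN x : nrm (- x) = nrm x.
Proof. by rewrite /nrm normrN. Qed.

Lemma nrmB x y : nrm (x - y) = nrm (y - x).
Proof. by rewrite -nrmN opprB. Qed.

Lemma nrm_sum (I : Type) (s : seq I) (f : I -> V) :
  nrm (\sum_(i <- s) f i) <= \sum_(i <- s) nrm (f i).
Proof.
elim: s => [|i s IHs]; first by rewrite !big_nil nrm0.
by rewrite !big_cons (le_trans (nrmD _ _))// lerD2l.
Qed.

End NormedZmod.

Lemma sqabs_nrm (z : C) : sqabs z = nrm z ^+ 2.
Proof. by apply: complexI; rewrite sqabsE nrmE rmorphXn. Qed.

Lemma nrmM (z w : C) : nrm (z * w) = nrm z * nrm w.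
Proof. by apply: complexI; rewrite rmorphM/= -!nrmE normrM. Qed.

Lemma nrm_real (t : R) : nrm (t%:C) = `|t|.
Proof. by rewrite /nrm normc_def/= expr0n addr0 sqrtr_sqr. Qed.

Lemma Re_le_nrm (z : C) : Re z <= nrm z.
Proof.
rewrite (le_trans (ler_norm _))// -(@ler_pXn2r _ 2) ?nnegrE ?nrm_ge0//.
by rewrite -sqabs_nrm /sqabs real_normK ?num_real// lerDl sqr_ge0.
Qed.

Lemma nrmZ {V : normedModType C} (a : C) (x : V) : nrm (a *: x) = nrm a * nrm x.
Proof. by apply: complexI; rewrite rmorphM/= -!nrmE normrZ. Qed.

(** The discriminant of a nonnegative quadratic polynomial in t. The degenerate
    case Z = 0 forces r = 0. *)
Lemma discriminant_le (e r Z : R) : 0 <= Z ->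
  (forall t, 0 <= e + 2 * t * r + t ^+ 2 * Z) -> r ^+ 2 <= e * Z.
Proof.
rewrite le_eqVlt => /predU1P[<-|Z0] h.
  have [->|r0] := eqVneq r 0; first by rewrite expr0n mulr0.
  have := h (- (e + 1) / (2 * r)); rewrite mulr0.
  by rewrite (_ : e + _ + _ = -1) ?ler0N1//; field; rewrite r0.
have := h (- r / Z); rewrite (_ : e + _ + _ = (e * Z - r ^+ 2) / Z).
  by rewrite pmulr_lge0 ?invr_gt0// subr_ge0.
by field; rewrite gt_eqF.
Qed.

End RealNorm.

Section HilbertSpace.
Context {R : realType} {H : hilbertType R}.
Local Notation C := R[i].
Local Notation Re := complex.Re.
Local Notation Im := complex.Im.
Implicit Types (x y z : H) (a : C) (S T : H -> H).

Lemma hdotDl x y z : hdot (x + y) z = hdot x z + hdot y z.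
Proof. exact: linearDl. Qed.

Lemma hdotDr x y z : hdot x (y + z) = hdot x y + hdot x z.
Proof. exact: linearDr. Qed.

Lemma hdotZl a x y : hdot (a *: x) y = a * hdot x y.
Proof. exact: linearZl_LR. Qed.

Lemma hdotZr a x y : hdot x (a *: y) = Num.conj a * hdot x y.
Proof. exact: linearZr_LR. Qed.

Lemma hdot0l x : hdot 0 x = 0. Proof. exact: linear0l. Qed.
Lemma hdot0r x : hdot x 0 = 0. Proof. exact: linear0r. Qed.

Lemma hdotNr x y : hdot x (- y) = - hdot x y. Proof. exact: linearNr. Qed.
Lemma hdotNl x y : hdot (- x) y = - hdot x y. Proof. exact: linearNl. Qed.

Lemma hdot_suml (I : Type) (s : seq I) (f : I -> H) y :
  hdot (\sum_(i <- s) f i) y = \sum_(i <- s) hdot (f i) y.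
Proof. by elim/big_rec2: _ => [|i a x _ <-]; rewrite ?hdot0l ?hdotDl. Qed.

Lemma hdotC x y : hdot x y = Num.conj (hdot y x).
Proof. by rewrite [LHS](hermC (hdot : {dot H for Num.conj})) expr0 mul1r. Qed.

Lemma hdotxx x : hdot x x = (nrm x ^+ 2)%:C.
Proof. by rewrite hdot_norm nrmE rmorphXn. Qed.

Lemma sqr_nrmD x y : nrm (x + y) ^+ 2 = nrm x ^+ 2 + nrm y ^+ 2 + 2 * Re (hdot x y).
Proof.
have : hdot (x + y) (x + y) = hdot x x + hdot y y + (hdot x y + hdot y x).
  by rewrite hdotDl !hdotDr; ring.
move=> /(congr1 (@complex.Re R)); rewrite !hdotxx !ReD/= => ->.
by rewrite (hdotC y x) Re_conj; ring.
Qed.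

Lemma hdot_CauchySchwarz x y : nrm (hdot x y) <= nrm x * nrm y.
Proof.
rewrite -(@ler_pXn2r _ 2) ?nnegrE ?mulr_ge0 ?nrm_ge0// exprMn.
have := nrm_ge0 y; rewrite le_eqVlt => /predU1P[/esym/nrm_eq0->|y0].
  by rewrite hdot0r !nrm0 expr0n mulr0.
set N := nrm y ^+ 2; set X := nrm x ^+ 2; set h := hdot x y.
have N0 : 0 < N by rewrite exprn_gt0.
have : (nrm (N%:C *: x - h *: y) ^+ 2)%:C = (N * (X * N - nrm h ^+ 2))%:C.
  rewrite -hdotxx !hdotDl !hdotDr !hdotNl !hdotNr !hdotZl !hdotZr !hdotxx.
  have E (a b c : R) : (a * (b * a - c))%:C = a%:C * (b%:C * a%:C - c%:C).
    by rewrite rmorphM rmorphB rmorphM.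
  rewrite -sqabs_nrm E sqabsE normCK (hdotC y x) -/h.
  have -> : Num.conj N%:C = N%:C by rewrite conj_Creal// complex_real.
  by rewrite -/N -/X; ring.
move=> /complexI E; have := sqr_ge0 (nrm (N%:C *: x - h *: y)).
by rewrite E pmulr_rge0// subr_ge0.
Qed.

Lemma hdot_inj x y : (forall z, hdot z x = hdot z y) -> x = y.
Proof.
move=> xy; apply/eqP; rewrite -subr_eq0; apply/eqP/nrm_eq0/eqP.
rewrite -sqrf_eq0; apply/eqP/complexI.
by rewrite -hdotxx hdotDr hdotNr xy subrr.
Qed.

Lemma linear_op0 T : linear T -> T 0 = 0.
Proof. by move=> lT; have := lT (-1) 0 0; rewrite scaler0 addr0 scaleN1r addNr. Qed.

Lemma linear_opD T : linear T -> {morph T : x y / x + y}.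
Proof. by move=> lT x y; have := lT 1 x y; rewrite !scale1r. Qed.

Lemma linear_opZ T : linear T -> forall a x, T (a *: x) = a *: T x.
Proof. by move=> lT a x; have := lT a x 0; rewrite (linear_op0 lT) !addr0. Qed.

Lemma bounded_opP T : bounded_op T <->
  linear T /\ exists2 M : R, 0 <= M & forall x, nrm (T x) <= M * nrm x.
Proof.
split=> -[lT]; last first.
  by move=> [M M0 TM]; split => //; exists M => x; rewrite !nrmE -rmorphM/= lecR.
move=> [M TM]; split => //; exists `|M| => // x.
have := TM x; rewrite !nrmE -rmorphM/= lecR => /le_trans; apply.
by rewrite ler_wpM2r ?nrm_ge0// ler_norm.
Qed.

End HilbertSpace.

Section Riesz.
Context {R : realType} {H : hilbertType R}.
Local Notation C := R[i].
Local Notation Re := complex.Re.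
Local Notation Im := complex.Im.
Implicit Types (x y z : H) (a : C) (S T : H -> H).

Lemma parallelogram x y :
  nrm (x - y) ^+ 2 = 2 * nrm x ^+ 2 + 2 * nrm y ^+ 2 - nrm (x + y) ^+ 2.
Proof. by rewrite !sqr_nrmD nrmN hdotNr ReN; ring. Qed.

(** The representing vector minimizes J x = |x|^2 - 2 Re (phi x). The parallelogram
    law makes the sublevel sets of J near its infimum small, so they generate a
    convergent filter; varying an almost minimal x along z shows that
    Re (<z, x> - phi z) is small, and the limit of the filter represents phi. *)
Lemma riesz (phi : H -> C) (M : R) :
  (forall x y, phi (x + y) = phi x + phi y) ->
  (forall a x, phi (a *: x) = a * phi x) ->
  0 <= M -> (forall x, nrm (phi x) <= M * nrm x) ->
  exists y, forall x, phi x = hdot x y.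
Proof.
move=> phiD phiZ M0 phiM.
pose J x : R := nrm x ^+ 2 - 2 * Re (phi x).
have JM x : - M ^+ 2 <= J x.
  rewrite /J; have := Re_le_nrm (phi x); have := phiM x.
  by have := sqr_ge0 (nrm x - M); nra.
have supJ : has_inf (range J) by split; [exists (J 0), 0|exists (- M ^+ 2) => _ [x _ <-]].
pose m := inf (range J).
have mJ x : m <= J x by apply: ge_inf; [exact: supJ.2|exists x].
have near_inf e : 0 < e -> exists x, J x < m + e.
  by move=> e0; have [_ [x _ <-] xe] := inf_adherent e0 supJ; exists x.
have nrm_half (x : H) : nrm (2^-1%:C *: x) ^+ 2 = nrm x ^+ 2 / 4.
  by rewrite nrmZ nrm_real ger0_norm ?invr_ge0//; field.
have J_close e x y : J x < m + e -> J y < m + e -> nrm (x - y) ^+ 2 <= 4 * e.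
  move=> xe ye; have := mJ (2^-1%:C *: (x + y)).
  rewrite parallelogram {1}/J nrm_half phiZ phiD ReZ ReD.
  by move: xe ye; rewrite /J; lra.
have J_var e x z : J x < m + e -> Re (hdot z x - phi z) ^+ 2 <= e * nrm z ^+ 2.
  move=> xe; apply: discriminant_le => [|t]; first exact: sqr_ge0.
  have := mJ (x + t%:C *: z); rewrite /J sqr_nrmD nrmZ nrm_real exprMn real_normK ?num_real//.
  rewrite phiD phiZ hdotZr ReD ReZ conj_Creal ?complex_real// ReZ.
  by rewrite ReD ReN (hdotC z) Re_conj; move: xe; rewrite /J; nra.
pose F : set_system H := filter_from [set e : R | 0 < e] (fun e => [set x | J x < m + e]).
have FF : ProperFilter F.
  apply: filter_from_proper => [|e /near_inf[x xe]]; last by exists x.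
  apply: filter_from_filter; first by exists 1 => /=.
  move=> e d e0 d0; exists (Num.min e d); first by rewrite /= lt_min e0.
  by move=> x /= /lt_le_trans xed; split; apply: xed; rewrite lerD2l ge_min lexx ?orbT.
have Fcvg : cvg F.
  apply: cauchy_cvg; apply/cauchy_exP => e e0.
  have eE := ge0_ReK (ltW e0); have re0 : 0 < Re e by rewrite -ltcR -eE.
  have d0 : 0 < Re e ^+ 2 / 8 by rewrite divr_gt0// exprn_gt0.
  have [x xd] := near_inf _ d0; exists x; exists (Re e ^+ 2 / 8) => // y yd.
  rewrite -ball_normE /= nrmE eE ltcR -(@ltr_pXn2r _ 2) ?nnegrE ?nrm_ge0 ?(ltW re0)//.
  by rewrite (le_lt_trans (J_close _ _ _ xd yd))//; lra.
have /cvg_ex[y Fy'] := Fcvg.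
have Fy (e : C) : 0 < e -> F [set x | `|y - x| < e].
  by move: e; apply/(@cvgrPdist_lt _ _ _ F _ id).
have y_approx d : 0 < d -> exists2 x, nrm (y - x) < d & J x < m + d ^+ 2.
  move=> d0; have dC : 0 < d%:C by rewrite -[0]/(0%:C) ltcR.
  have Fd : F [set x | J x < m + d ^+ 2] by exists (d ^+ 2) => //=; rewrite exprn_gt0.
  have [x [/= + xd]] := filter_ex (filterI (Fy _ dC) Fd).
  by rewrite nrmE ltcR; exists x.
have Re_eq z : Re (hdot z y - phi z) = 0.
  apply/eqP; rewrite -normr_le0; apply/ler_addgt0Pr => e e0; rewrite add0r.
  have Z0 := nrm_ge0 z; pose d := e / (2 * nrm z + 1).
  have d0 : 0 < d by rewrite divr_gt0//; lra.
  have [x xd Jx] := y_approx d d0.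
  have -> : hdot z y - phi z = hdot z (y - x) + (hdot z x - phi z).
    by rewrite hdotDr hdotNr; ring.
  rewrite ReD (le_trans (ler_normD _ _))//.
  have h1 : `|Re (hdot z x - phi z)| <= d * nrm z.
    have dZ := mulr_ge0 (ltW d0) Z0; rewrite -(@ler_pXn2r _ 2) ?nnegrE//.
    by rewrite real_normK ?num_real// exprMn; exact: J_var.
  have h2 : `|Re (hdot z (y - x))| <= nrm z * d.
    rewrite (@le_trans _ _ (nrm (hdot z (y - x))))//.
      by rewrite ler_norml Re_le_nrm andbT lerNl -ReN -nrmN Re_le_nrm.
    by rewrite (le_trans (hdot_CauchySchwarz _ _))// ler_wpM2l// ltW.
  have : d * (2 * nrm z + 1) = e by rewrite divfK// gt_eqF//; lra.
  by nra.
exists y; move=> x; apply/esym/eqP; rewrite -subr_eq0; apply/eqP.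
have := Re_eq x; have := Re_eq ('i *: x); rewrite hdotZl phiZ -mulrBr.
by case: (hdot x y - phi x) => a b /=; rewrite !mul0r mul1r sub0r => /eqP; rewrite oppr_eq0 => /eqP -> ->.
Qed.

End Riesz.

Section BoundedOperators.
Context {R : realType} {H : hilbertType R}.
Local Notation C := R[i].
Local Notation Re := complex.Re.
Local Notation Im := complex.Im.
Implicit Types (x y z : H) (a : C) (S T U : H -> H).

Lemma bounded_op_id : bounded_op (id : H -> H).
Proof. by apply/bounded_opP; split => //; exists 1 => // x; rewrite mul1r. Qed.

Lemma bounded_op_comp T U : bounded_op T -> bounded_op U -> bounded_op (T \o U).
Proof.
move=> /bounded_opP[lT [M M0 TM]] /bounded_opP[lU [N N0 UN]].
apply/bounded_opP; split=> [a x y|]; first by rewrite /= lU lT.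
exists (M * N) => [|x /=]; first exact: mulr_ge0.
by rewrite (le_trans (TM _))// -mulrA ler_wpM2l.
Qed.

Lemma bounded_opD T U : bounded_op T -> bounded_op U -> bounded_op (T + U).
Proof.
move=> /bounded_opP[lT [M M0 TM]] /bounded_opP[lU [N N0 UN]].
apply/bounded_opP; split=> [a x y|].
  by rewrite !fctE lU lT scalerDr addrACA.
exists (M + N) => [|x /=]; first exact: addr_ge0.
by rewrite (le_trans (nrmD _ _))// mulrDl lerD.
Qed.

Lemma bounded_opZ a T : bounded_op T -> bounded_op (a *: T).
Proof.
move=> /bounded_opP[lT [M M0 TM]]; apply/bounded_opP; split=> [b x y|].
  by rewrite !fctE lT scalerDr !scalerA mulrC.
exists (nrm a * M) => [|x]; first by rewrite mulr_ge0// nrm_ge0.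
by rewrite fctE nrmZ -mulrA ler_wpM2l// nrm_ge0.
Qed.

Lemma bounded_opN T : bounded_op T -> bounded_op (- T).
Proof. by move=> /(bounded_opZ (-1)); rewrite scaleN1r. Qed.

Lemma bounded_op0 : bounded_op (0 : H -> H).
Proof. by rewrite -(scale0r (id : H -> H)); exact/bounded_opZ/bounded_op_id. Qed.

Lemma bounded_op_sum (I : Type) (s : seq I) (f : I -> H -> H) :
  (forall i, bounded_op (f i)) -> bounded_op (\sum_(i <- s) f i).
Proof.
by move=> bf; elim/big_ind: _ => // [|T U]; [exact: bounded_op0|exact: bounded_opD].
Qed.

Lemma opnorm_has_sup T : bounded_op T ->
  has_sup [set Re `|T x| | x in [set x : H | `|x| <= 1]].
Proof.
move=> /bounded_opP[_ [M M0 TM]]; split.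
  by exists (Re `|T 0|), 0 => //=; rewrite normr0.
exists M => _ [x /= x1 <-]; rewrite (le_trans (TM x))//.
by rewrite ler_piMr// -lecR -nrmE.
Qed.

Lemma nrm_opnorm T x : bounded_op T -> nrm (T x) <= opnorm T * nrm x.
Proof.
move=> bT; have [lT _] := bT.
have := nrm_ge0 x; rewrite le_eqVlt => /predU1P[/esym/nrm_eq0->|x0].
  by rewrite (linear_op0 lT) !nrm0 mulr0.
rewrite -ler_pdivrMr// mulrC.
have -> : (nrm x)^-1 * nrm (T x) = nrm (T ((nrm x)^-1%:C *: x)).
  by rewrite (linear_opZ lT) nrmZ nrm_real ger0_norm// invr_ge0 ltW.
apply: sup_upper_bound; first exact: opnorm_has_sup.
eexists; last by [].
by rewrite /= nrmE nrmZ nrm_real ger0_norm ?invr_ge0 ?(ltW x0)// mulVf// gt_eqF.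
Qed.

Lemma opnorm_ge0 T : bounded_op T -> 0 <= opnorm T.
Proof.
move=> bT; apply: le_trans (nrm_ge0 (T 0)) _; apply: sup_upper_bound.
  exact: opnorm_has_sup.
by exists 0 => //=; rewrite normr0.
Qed.

Lemma opnorm_le T M : 0 <= M -> (forall x, nrm (T x) <= M * nrm x) -> opnorm T <= M.
Proof.
move=> M0 TM; apply: ge_sup; first by exists (Re `|T 0|), 0 => //=; rewrite normr0.
move=> _ [x /= x1 <-]; rewrite (le_trans (TM x))//.
by rewrite ler_piMr// -lecR -nrmE.
Qed.

Lemma ex_adjoint T : bounded_op T ->
  exists S, forall x y, hdot (T x) y = hdot x (S y).
Proof.
move=> /bounded_opP[lT [M M0 TM]].
suff /choice[S TS] : forall y, exists s, forall x, hdot (T x) y = hdot x s by exists S.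
move=> y; apply: (@riesz _ _ _ (M * nrm y)).
- by move=> x x'; rewrite (linear_opD lT) hdotDl.
- by move=> a x; rewrite (linear_opZ lT) hdotZl.
- by rewrite mulr_ge0// nrm_ge0.
- move=> x; rewrite (le_trans (hdot_CauchySchwarz _ _))//.
  by rewrite mulrAC ler_wpM2r// nrm_ge0.
Qed.

Lemma adjointP T : bounded_op T -> forall x y, hdot (T x) y = hdot x (adjoint T y).
Proof.
move=> /ex_adjoint exT.
by have := @xgetPex _ (fun=> 0) [set S | forall x y, hdot (T x) y = hdot x (S y)] exT.
Qed.

Lemma adjointP' T : bounded_op T -> forall x y, hdot (adjoint T x) y = hdot x (T y).
Proof. by move=> bT x y; rewrite hdotC -adjointP// -hdotC. Qed.

Lemma adjoint_unique T S : bounded_op T ->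
  (forall x y, hdot (T x) y = hdot x (S y)) -> adjoint T = S.
Proof.
by move=> bT TS; apply/funext => y; apply: hdot_inj => x; rewrite -adjointP.
Qed.

Lemma adjoint_id : adjoint (id : H -> H) = id.
Proof. by apply: adjoint_unique => //; exact: bounded_op_id. Qed.

Lemma adjoint_comp T U : bounded_op T -> bounded_op U ->
  adjoint (T \o U) = adjoint U \o adjoint T.
Proof.
move=> bT bU; apply: adjoint_unique; first exact: bounded_op_comp.
by move=> x y; rewrite /= !adjointP.
Qed.

(** Polarization: the values of the form at x + y and at x + i y are real. *)
Lemma positive_hermitian T : linear T -> (forall x, 0 <= hdot (T x) x) ->
  forall x y, hdot (T y) x = Num.conj (hdot (T x) y).
Proof.
move=> lT T0 x y.
have Im0 z : Im (hdot (T z) z) = 0.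
  by have /ge0_ReK -> := T0 z.
have ImD (z w : C) : Im (z + w) = Im z + Im w by case: z; case: w.
have /eqP : Im (hdot (T (x + y)) (x + y)) = 0 := Im0 _.
have /eqP : Im (hdot (T (x + 'i *: y)) (x + 'i *: y)) = 0 := Im0 _.
rewrite !(linear_opD lT) (linear_opZ lT) !hdotDl !hdotDr !hdotZl !hdotZr !ImD !Im0.
have -> : Im (Num.conj 'i * hdot (T x) y) = - Re (hdot (T x) y).
  by case: (hdot (T x) y) => a b /=; ring.
have -> : Im ('i * hdot (T y) x) = Re (hdot (T y) x).
  by case: (hdot (T y) x) => a b /=; ring.
have -> : Im ('i * (Num.conj 'i * hdot (T y) y)) = 0.
  by have /ge0_ReK -> := T0 y; rewrite /=; ring.
case: (hdot (T x) y) => a b; case: (hdot (T y) x) => c d /=.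
move=> /eqP h1 /eqP h2; apply/eqP; rewrite eq_complex /=.
by apply/andP; split; apply/eqP; lra.
Qed.

(** With S the inverse of T, the form is nonnegative at x - t S x. As
    <T x, S x> = |x|^2, this reads 0 <= <T x, x> - 2 t |x|^2 + t^2 <x, S x>, and the
    last term is at most t^2 M |x|^2 when M bounds S. *)
Lemma positive_invertible_ge T : positive_op T -> invertible_op T ->
  exists2 d : R, 0 < d & forall x, d * nrm x ^+ 2 <= Re (hdot (T x) x).
Proof.
move=> [[lT _] T0] [S [/bounded_opP[lS [M M0 SM]] _ TS]].
have TSx x : T (S x) = x by have := congr1 (fun f => f x) TS.
have M1 : 0 < M + 1 by lra.
exists (M + 1)^-1 => [|x]; first by rewrite invr_gt0.
set t := (M + 1)^-1; have t0 : 0 < t by rewrite invr_gt0.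
have : 0 <= Re (hdot (T (x + (- t)%:C *: S x)) (x + (- t)%:C *: S x)).
  by rewrite -lecR -ge0_ReK.
rewrite (linear_opD lT) (linear_opZ lT) !hdotDl !hdotDr !hdotZl !hdotZr TSx.
rewrite -[hdot (T x) (S x)]conjCK -(positive_hermitian lT T0) TSx.
rewrite hdotxx !conj_Creal ?complex_real// !ReD !ReZ /=.
have : Re (hdot x (S x)) <= M * nrm x ^+ 2.
  rewrite (le_trans (Re_le_nrm _))// (le_trans (hdot_CauchySchwarz _ _))//.
  by rewrite mulrC expr2 mulrA ler_wpM2r ?nrm_ge0.
have t1 : t * (M + 1) = 1 by rewrite mulVf// gt_eqF.
set X := nrm x ^+ 2; have X0 : 0 <= X by exact: sqr_ge0.
set D := Re (hdot x _) => DM.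
have : t ^+ 2 * D <= t * X.
  apply: (@le_trans _ _ (t ^+ 2 * (M * X))); first by rewrite ler_wpM2l ?sqr_ge0.
  rewrite (_ : _ * _ = (t * M) * (t * X)); last by ring.
  apply: ler_piMl; first exact: mulr_ge0 (ltW t0) X0.
  by move: t0 t1; lra.
by lra.
Qed.

End BoundedOperators.

(** * Decay at a point of the polydomain *)

Section WordOperators.
Context {R : realType} {H : hilbertType R}.
Local Notation Re := complex.Re.

Lemma word_op_bounded n (X : 'I_n -> H -> H) w :
  (forall j, bounded_op (X j)) -> bounded_op (word_op X w).
Proof.
move=> bX; elim: w => [|j w IHw]; first exact: bounded_op_id.
exact: bounded_op_comp (bX j) IHw.
Qed.

Lemma word_op_cat n (X : 'I_n -> H -> H) u v :
  word_op X (u ++ v) = word_op X u \o word_op X v.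
Proof. by elim: u => //= j u IHu; rewrite /word_op /= -/(word_op X _) IHu. Qed.

Lemma Re_hdot_Phi n (q : posreg R n) (X : 'I_n -> H -> H) (Y : H -> H) x :
  (forall j, bounded_op (X j)) ->
  Re (hdot (Phi q X Y x) x) =
  \sum_(w <- finsupp q) q w *
    Re (hdot (Y (adjoint (word_op X w) x)) (adjoint (word_op X w) x)).
Proof.
move=> bX; rewrite /Phi fct_sumE hdot_suml.
elim/big_rec2: _ => [|w a z _ <-] //; rewrite ReD; congr (_ + _).
by rewrite fctE hdotZl ReZ /= adjointP//; exact: word_op_bounded.
Qed.

End WordOperators.

Section WordDecayPolydomain.
Context {R : realType} {H : hilbertType R} {k : nat} {n : 'I_k -> nat}.
Variables (q : forall i, posreg R (n i)) (X : forall i, 'I_(n i) -> H -> H).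
Local Notation Re := complex.Re.
Hypothesis DX : polydomain q X.

Let bX i j : bounded_op (@X i j).
Proof. by case: DX => -[]. Qed.

(** The partial defect operators, along the list of indices. Removing the head i
    of i :: s adds Phi_i (Z s), which is positive, so the operators Z s increase from
    the full defect, bounded below by d, to the identity. *)
Let Z (s : seq 'I_k) : H -> H :=
  (\big[comp/id]_(i <- s) (fun Y => Y - Phi (q i) (@X i) Y)) id.

Let z s x := Re (hdot (Z s x) x).

Let Z_Delta s1 s2 : s1 ++ s2 = index_enum 'I_k ->
  Z s2 = Delta q (fun i => i \in s2) X id.
Proof.
move=> s12; have u12 : uniq (s1 ++ s2) by rewrite s12 index_enum_uniq.
rewrite /Delta -s12 /Z; congr (_ id).
have : {in s1, forall i, i \notin s2}.
  move: u12; rewrite cat_uniq => /and3P[_ /hasPn h _] i is1.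
  by apply/negP => /h; rewrite /= is1.
elim: s1 {s12 u12} => [_|i s1 IHs1 s12]; last first.
  rewrite /= big_cons (negbTE (s12 i (mem_head _ _))) IHs1// => l ls.
  by apply: s12; rewrite inE ls orbT.
by rewrite /= [LHS]big_seq [RHS]big_seq; apply: eq_bigr => i ->.
Qed.

Let z_cons i s x : z (i :: s) x = z s x -
  \sum_(w <- finsupp (q i)) q i w * z s (adjoint (word_op (@X i) w) x).
Proof.
rewrite /z /Z big_cons /=; set T := (X in X id); rewrite -/(T id).
by rewrite fctE hdotDl ReD hdotNl ReN Re_hdot_Phi.
Qed.

Let z_ge0 s1 s2 x : s1 ++ s2 = index_enum 'I_k -> 0 <= z s2 x.
Proof.
move=> /Z_Delta; rewrite /z => ->; case: DX => -[_ _ P] _ _.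
by have [_ /(_ x) h] := P (fun i => i \in s2); rewrite -lecR -ge0_ReK.
Qed.

Let Phi_ge0 i s1 s2 x : s1 ++ s2 = index_enum 'I_k ->
  0 <= \sum_(w <- finsupp (q i)) q i w * z s2 (adjoint (word_op (@X i) w) x).
Proof.
move=> s12; apply: sumr_ge0 => w _; rewrite mulr_ge0 ?coef_ge0//.
exact: z_ge0 s12.
Qed.

Let z_le s1 s2 x : s1 ++ s2 = index_enum 'I_k -> z s2 x <= nrm x ^+ 2.
Proof.
elim: s2 s1 => [|i s2 IHs] s1 s12.
  by rewrite /z /Z big_nil /= hdotxx.
have s12' : rcons s1 i ++ s2 = index_enum 'I_k by rewrite cat_rcons.
by rewrite z_cons (le_trans _ (IHs _ s12'))// gerBl (Phi_ge0 _ _ s12').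
Qed.

Let z_ge : exists2 d : R, 0 < d < 1 & forall s1 s2 x,
  s1 ++ s2 = index_enum 'I_k -> d * nrm x ^+ 2 <= z s2 x.
Proof.
have [_ Dp Di] := DX; have [d d0 dD] := positive_invertible_ge Dp Di.
exists (Num.min d 2^-1).
  by rewrite lt_min d0 invr_gt0 ltr0n/= gt_min invf_lt1 ?ltr1n ?orbT.
elim/last_ind => [|s1 i IHs1] s2 x s12; last first.
  have := IHs1 (i :: s2) x; rewrite -cat_rcons => /(_ s12) /le_trans; apply.
  by rewrite z_cons gerBl (Phi_ge0 _ _ s12).
rewrite (@le_trans _ _ (d * nrm x ^+ 2))//.
  by rewrite ler_wpM2r ?sqr_ge0// ge_min lexx.
rewrite (le_trans (dD x))// /z (Z_Delta s12) (_ : (fun i => _) = xpredT)//.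
by apply/funext => i; move: s12 => /= ->; rewrite mem_index_enum.
Qed.

(** For the index i, take Z = Z s2 where s2 follows i in the list of indices:
    Z - Phi_i(Z) = Z (i :: s2) >= d >= d Z, so Phi_i(Z) <= (1 - d) Z. As
    d <= Z <= 1, the decay of Z under words passes to the identity at the cost of a
    factor 1 / d. *)
Lemma polydomain_word_decay : exists2 C : R, 0 <= C & exists2 rho : R, 0 < rho < 1 &
  forall i p x, \sum_(w <- words p) weight (q i) w *
    nrm (adjoint (word_op (@X i) w) x) ^+ 2 <= C * rho ^+ p * nrm x ^+ 2.
Proof.
have [d /andP[d0 d1] dz] := z_ge.
exists d^-1; first by rewrite invr_ge0 ltW.
pose D := (\max_(i < k) \max_(w <- finsupp (q i)) size w)%N.
have qD i w : w \in finsupp (q i) -> (size w <= D)%N.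
  move=> wq; apply: leq_trans (leq_bigmax i).
  by apply: (leq_bigmax_seq (F := fun w : seq 'I_(n i) => size w)).
(* By the Bernoulli inequality, (1 - y)^D >= 1 - D y >= 1 - d. *)
pose y := d / D.+1%:R.
have y0 : 0 < y by rewrite divr_gt0.
have yd : D.+1%:R * y = d by rewrite mulrC divfK.
have y1 : y < 1 by rewrite (le_lt_trans _ d1)// -yd ler_peMl ?ler1n// ltW.
exists (1 - y) => [|i p x]; first by rewrite subr_gt0 y1 gtrBl.
have rhoD : 1 - d <= (1 - y) ^+ D.
  apply: le_trans (bernoulli_le D _); last by rewrite !ltW.
  by rewrite -yd -natr1; lra.
have : i \in index_enum 'I_k by exact: mem_index_enum.
case/splitPr E : _ / => [s1 s2]; move/esym: E => E.
have E' : rcons s1 i ++ s2 = index_enum 'I_k by rewrite cat_rcons.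
have := @word_decay _ _ (q i) H (fun w => adjoint (word_op (@X i) w)) (z s2) (1 - y) D.
move=> /(_ _ _ _ _ _ _ p x) decay.
rewrite -[leRHS]mulrA ler_pdivlMl// mulr_sumr.
apply: (@le_trans _ _ (\sum_(w <- words p) weight (q i) w *
    z s2 (adjoint (word_op (@X i) w) x))).
  apply: ler_sum => w _; rewrite mulrCA ler_wpM2l ?(ltW (weight_gt0 _ _))//.
  exact: dz E'.
apply: (@le_trans _ _ ((1 - y) ^+ p * z s2 x)); last first.
  by rewrite ler_wpM2l ?exprn_ge0 ?subr_ge0 ?(ltW y1)// (z_le _ E').
apply: decay => {p x}.
- by move=> x; rewrite adjoint_id.
- by move=> u v x; rewrite word_op_cat adjoint_comp//; exact: word_op_bounded.
- by move=> x; exact: z_ge0 E'.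
- by rewrite subr_gt0 y1/= gerBl ltW.
- exact: qD.
- move=> x; have := z_cons i s2 x; have := dz _ _ x E; have := z_le x E'.
  have := z_ge0 x E' => z0 zN dN zE.
  rewrite (@le_trans _ _ ((1 - d) * z s2 x))//; last by rewrite ler_wpM2r.
  have : d * z s2 x <= d * nrm x ^+ 2 by rewrite ler_wpM2l// ltW.
  by lra.
Qed.

End WordDecayPolydomain.

Section Multiwords.
Context {R : realType} {k : nat} {n : 'I_k -> nat} (q : forall i, posreg R (n i)).
Implicit Types (w : multiword n) (s : seq 'I_k) (p : {ffun 'I_k -> nat}).

Definition mweight w : R := \prod_i weight (q i) (w i).

Definition empty_multiword : multiword n := [ffun=> [::]].

(** The multiwords with components of length p i for i in s and empty components
    elsewhere, built so that a sum over them is an iterated sum over words. *)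
Fixpoint multiwords p s : seq (multiword n) :=
  if s is i :: s' then [seq @subst_word _ n w i v | w <- multiwords p s', v <- words (p i)]
  else [:: empty_multiword].

Lemma mem_multiwords p s w : uniq s ->
  (forall i, i \in s -> size (w i) = p i) -> (forall i, i \notin s -> w i = [::]) ->
  w \in multiwords p s.
Proof.
elim: s w => [|i s IHs] w /= => [_ _ w0|/andP[is_ us] ws w0].
  by rewrite inE; apply/eqP/ffunP => i; rewrite ffunE w0.
apply/allpairsP; exists (@subst_word _ n w i [::], w i); split => /=.
- apply: IHs => // l ls.
    have il : i != l by apply: contraNneq is_ => ->.
    by rewrite subst_word_out// ws// inE ls orbT.
  have [<-|il] := eqVneq i l; first by rewrite subst_word_in.
  by rewrite subst_word_out// w0// inE negb_or eq_sym il.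
- by rewrite mem_words ws// mem_head.
- apply/ffunP => l; have [<-|il] := eqVneq i l; first by rewrite subst_word_in.
  by rewrite !subst_word_out.
Qed.

Definition multidegree_seq p : seq (multiword n) := fset_set (multidegree p).

Lemma mem_multidegree_seq p w :
  (w \in multidegree_seq p) = `[< forall i, size (w i) = p i >].
Proof.
rewrite /multidegree_seq in_fset_set; last exact: finite_multidegree.
by apply/idP/asboolP; rewrite inE.
Qed.

(** The square of the norm of the vector obtained by applying the homogeneous
    part of multidegree p, evaluated at the universal model, to the vacuum. *)
Definition energy (F : multiword n -> R[i]) p : R :=
  \sum_(w <- multidegree_seq p) sqabs (F w) / mweight w.

Lemma mweight_gt0 w : 0 < mweight w.
Proof. by apply: prodr_gt0 => i _; exact: weight_gt0. Qed.

Lemma energy_ge0 F p : 0 <= energy F p.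
Proof.
by apply: sumr_ge0 => w _; rewrite divr_ge0 ?sqabs_ge0// ltW// mweight_gt0.
Qed.

End Multiwords.

Section HomogeneousParts.
Context {R : realType} {H : hilbertType R} {k : nat} {n : 'I_k -> nat}.
Variables (q : forall i, posreg R (n i)) (X : forall i, 'I_(n i) -> H -> H).
Local Notation Re := complex.Re.
Implicit Types (w : multiword n) (s : seq 'I_k) (p : {ffun 'I_k -> nat}).
Hypothesis bX : forall i j, bounded_op (@X i j).

Let op s w : H -> H := \big[comp/id]_(i <- s) word_op (@X i) (w i).

Let op_bounded s w : bounded_op (op s w).
Proof.
rewrite /op; elim: s => [|i s IHs]; first by rewrite big_nil; exact: bounded_op_id.
by rewrite big_cons; apply: bounded_op_comp IHs; exact: word_op_bounded.
Qed.

Lemma multiword_op_bounded w : bounded_op (multiword_op X w).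
Proof. exact: op_bounded. Qed.

Lemma hom_partE F p x :
  hom_part F X p x = \sum_(w <- multidegree_seq p) F w *: multiword_op X w x.
Proof.
rewrite /hom_part fsbig_finite ?fct_sumE//; exact: finite_multidegree.
Qed.

Lemma hom_part_bounded F p : bounded_op (hom_part F X p).
Proof.
rewrite /hom_part fsbig_finite; last exact: finite_multidegree.
by apply: bounded_op_sum => w; apply: bounded_opZ; exact: multiword_op_bounded.
Qed.

Let subst_word_op s i (v : seq 'I_(n i)) w : i \notin s ->
  op s (@subst_word _ n w i v) = op s w.
Proof.
move=> is_; rewrite /op big_seq [RHS]big_seq; apply: eq_bigr => l ls.
by rewrite subst_word_out//; apply: contraNneq is_ => ->.
Qed.

Variables (C rho : R).
Hypotheses (C0 : 0 <= C) (rho0 : 0 < rho)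
 (decay : forall i t x, \sum_(u <- words t) weight (q i) u *
    nrm (adjoint (word_op (@X i) u) x) ^+ 2 <= C * rho ^+ t * nrm x ^+ 2).

(** The adjoint of a composition along i :: s applies the adjoint for i before the
    adjoints for s, so the sum over the words of index i is outermost and the bounds
    multiply. *)
Let multiwords_decay p s x : uniq s ->
  \sum_(w <- multiwords p s) (\prod_(i <- s) weight (q i) (w i)) *
    nrm (adjoint (op s w) x) ^+ 2 <=
  (\prod_(i <- s) (C * rho ^+ p i)) * nrm x ^+ 2.
Proof.
elim: s x => [|i s IHs] x.
  by rewrite big_seq1 !big_nil /op big_nil adjoint_id.
move=> /= /andP[is_ us]; rewrite big_allpairs_dep exchange_big/=.
apply: (@le_trans _ _ (\sum_(v <- words (p i)) weight (q i) v *
   ((\prod_(i <- s) (C * rho ^+ p i)) * nrm (adjoint (word_op (@X i) v) x) ^+ 2))).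
  apply: ler_sum => v _; rewrite (le_trans _ (ler_wpM2l _ (IHs _ us)))//; last first.
    exact/ltW/weight_gt0.
  rewrite mulr_sumr; apply: ler_sum => w _.
  have -> : op (i :: s) (subst_word w v) = word_op (@X i) v \o op s w.
    by rewrite -(subst_word_op v w is_) /op big_cons subst_word_in.
  rewrite adjoint_comp//; last exact: word_op_bounded.
  rewrite big_cons subst_word_in [leRHS]mulrA.
  rewrite [X in _ * X * _ <= _]big_seq [X in _ <= _ * X * _]big_seq.
  rewrite (eq_bigr (fun l => weight (q l) (w l))) // => l ls.
  by rewrite subst_word_out//; apply: contraNneq is_ => ->.
rewrite (_ : \sum_(v <- _) _ = (\prod_(i <- s) (C * rho ^+ p i)) *
    \sum_(v <- words (p i)) weight (q i) v *
      nrm (adjoint (word_op (@X i) v) x) ^+ 2); last first.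
  by rewrite mulr_sumr; apply: eq_bigr => v _; rewrite mulrCA.
rewrite big_cons [leRHS]mulrAC [leRHS]mulrC ler_wpM2l//.
by apply: prodr_ge0 => l _; rewrite mulr_ge0// exprn_ge0// ltW.
Qed.

Lemma multidegree_decay p x :
  \sum_(w <- multidegree_seq p) mweight q w *
    nrm (adjoint (multiword_op X w) x) ^+ 2 <=
  C ^+ k * rho ^+ total_degree p * nrm x ^+ 2.
Proof.
have -> : C ^+ k * rho ^+ total_degree p = \prod_i (C * rho ^+ p i).
  by rewrite big_split/= big_const_ord iter_mulr_1 -expr_sum.
apply: le_trans (multiwords_decay p x (index_enum_uniq _)).
apply: ler_sum_uniq => [|w|w]; first exact: fset_uniq.
  rewrite mem_multidegree_seq => /asboolP wp; apply: mem_multiwords => //.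
    exact: index_enum_uniq.
  by move=> i; rewrite mem_index_enum.
by rewrite mulr_ge0 ?sqr_ge0// ltW// mweight_gt0.
Qed.

(** With y the value of the homogeneous part at x, |y|^2 is the sum of
    c_w <x, X_w^* y>; Cauchy-Schwarz with weights b_w bounds it by |x| times the
    square root of the energy times the sum of b_w |X_w^* y|^2, and the latter decays
    geometrically. *)
Lemma hom_part_energy F p x :
  nrm (hom_part F X p x) ^+ 2 <=
  C ^+ k * rho ^+ total_degree p * energy q F p * nrm x ^+ 2.
Proof.
set y := hom_part F X p x.
have D0 : 0 <= C ^+ k * rho ^+ total_degree p.
  by rewrite mulr_ge0// exprn_ge0// ltW.
have [y0|y0] := eqVneq (nrm y ^+ 2) 0.
  by rewrite y0; apply: mulr_ge0 (sqr_ge0 _); exact: mulr_ge0 D0 (energy_ge0 _ _ _).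
have {}y0 : 0 < nrm y ^+ 2 by rewrite lt_neqAle eq_sym y0 sqr_ge0.
pose a w : R := nrm (F w) / Num.sqrt (mweight q w).
pose b w : R := Num.sqrt (mweight q w) * nrm (adjoint (multiword_op X w) y).
have ya : nrm y ^+ 2 <= nrm x * \sum_(w <- multidegree_seq p) a w * b w.
  have -> : nrm y ^+ 2 = Re (hdot y y) by rewrite hdotxx.
  rewrite {1}/y hom_partE hdot_suml (le_trans (Re_le_nrm _))//.
  rewrite (le_trans (nrm_sum _ _))// mulr_sumr; apply: ler_sum => w _.
  rewrite hdotZl nrmM adjointP; last exact: multiword_op_bounded.
  rewrite (le_trans (ler_wpM2l (nrm_ge0 _) (hdot_CauchySchwarz _ _)))//.
  rewrite /a /b mulrCA mulrA -mulrA [_ / _ * _]mulrA divfK//.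
  by rewrite gt_eqF// sqrtr_gt0 mweight_gt0.
have ab : (\sum_(w <- multidegree_seq p) a w * b w) ^+ 2 <=
    energy q F p * (C ^+ k * rho ^+ total_degree p * nrm y ^+ 2).
  apply: le_trans (sum_CauchySchwarz _ _ _) _.
  apply: ler_pM; do ?by apply: sumr_ge0 => w _; exact: sqr_ge0.
    apply: ler_sum => w _; rewrite /a exprMn exprVn sqr_sqrtr ?sqabs_nrm//.
    exact/ltW/mweight_gt0.
  apply: le_trans (multidegree_decay _ _); apply: ler_sum => w _.
  by rewrite /b exprMn sqr_sqrtr//; exact/ltW/mweight_gt0.
rewrite -(ler_pM2r y0) -expr2.
apply: (@le_trans _ _ ((nrm x * \sum_(w <- multidegree_seq p) a w * b w) ^+ 2)).
  rewrite ler_pXn2r ?nnegrE ?sqr_ge0// mulr_ge0 ?nrm_ge0//.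
  apply: sumr_ge0 => w _; rewrite /a /b.
  by rewrite !mulr_ge0 ?invr_ge0 ?sqrtr_ge0 ?nrm_ge0.
rewrite exprMn (le_trans (ler_wpM2l _ ab)) ?sqr_ge0//.
by rewrite le_eqVlt; apply/orP; left; apply/eqP; ring.
Qed.

End HomogeneousParts.

Lemma polydomain_hom_part (R : realType) (H : hilbertType R) (k : nat)
    (n : 'I_k -> nat) (q : forall i, posreg R (n i))
    (X : forall i, 'I_(n i) -> H -> H) : polydomain q X ->
  exists2 C : R, 0 <= C & exists2 rho : R, 0 < rho < 1 & forall F p x,
    nrm (hom_part F X p x) ^+ 2 <=
    C * rho ^+ total_degree p * energy q F p * nrm x ^+ 2.
Proof.
move=> DX; have [C C0 [rho /andP[r0 r1] decay]] := polydomain_word_decay DX.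
have bX i j : bounded_op (@X i j) by case: DX => -[].
exists (C ^+ k); first exact: exprn_ge0.
exists rho; first by rewrite r0.
by move=> F p x; exact: (hom_part_energy bX C0 r0 decay).
Qed.

(** * Convergence of homogeneous expansions *)

Section AbsoluteConvergence.
Context {R : realType} {H : hilbertType R} {I : choiceType}.
Local Notation psum := summability.partial_sum.
Implicit Types (u : I -> R) (A B : {fset I}).

(** Choose A with a partial sum close to the supremum. *)
Lemma small_tails u (e : R) : (forall i, 0 <= u i) -> bounded_psum u -> 0 < e ->
  exists A, forall B, [disjoint A & B]%fset -> \sum_(i <- B) u i <= e.
Proof.
move=> u0 [M uM] e0.
pose S := range (fun A => \sum_(i <- A) u i).
have supS : has_sup S.
  split; first by exists (\sum_(i <- fset0) u i), fset0.
  by exists M => _ [A _ <-].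
have [_ [A _ <-] Ae] := sup_adherent e0 supS.
exists A => B AB.
have : \sum_(i <- (A `|` B)%fset) u i <= sup S.
  by apply: sup_upper_bound => //; exists (A `|` B)%fset.
suff : \sum_(i <- A) u i + \sum_(i <- B) u i <= \sum_(i <- (A `|` B)%fset) u i by lra.
rewrite -big_cat; apply: ler_sum_uniq => [|i|//]; last first.
  by rewrite mem_cat inE.
rewrite cat_uniq !fset_uniq andbT/=; apply/hasPn => i iB.
by apply/negP => iA; have := fdisjointP AB i iA; rewrite iB.
Qed.

(** The pointwise limits exist by completeness, and the tails of u bound the
    distance to them uniformly on the unit ball. *)
Lemma operator_series_cvg (T : I -> H -> H) u :
  (forall i, bounded_op (T i)) -> (forall i, 0 <= u i) -> bounded_psum u ->
  (forall i x, nrm (T i x) <= u i * nrm x) ->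
  exists S, bounded_op S /\
    opnorm (psum T A - S) @[A --> summability.totally] --> (0 : R).
Proof.
move=> bT u0 bu Tu.
have bpsum A : bounded_op (psum T A) by rewrite psumE; exact: bounded_op_sum.
have tails (e : R) : 0 < e -> exists A0, forall A x, (A0 `<=` A)%fset ->
    nrm (psum T A x - psum T A0 x) <= e * nrm x.
  move=> e0; have [A0 A0e] := small_tails u0 bu e0; exists A0 => A x A0A.
  rewrite !psumE !fct_sumE (big_fsetID _ (mem A0) A)/=.
  have -> : [fset i in A | i \in A0]%fset = A0.
    apply/fsetP => i; rewrite !inE/= andbC; case: (boolP (i \in A0)) => //= iA.
    exact: (fsubsetP A0A).
  rewrite addrAC subrr add0r (le_trans (nrm_sum _ _))//.
  apply: (@le_trans _ _ (\sum_(i <- [fset i in A | i \notin A0]%fset) u i * nrm x)).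
    by apply: ler_sum => i _.
  rewrite -mulr_suml ler_wpM2r ?nrm_ge0// A0e//.
  by apply/fdisjointP => i iA; rewrite !inE/= iA andbF.
have Tcvg x : cvg (psum T A x @[A --> summability.totally]).
  apply: cauchy_cvg; apply/cauchy_exP => e e0.
  have eE := ge0_ReK (ltW e0); have re0 : 0 < complex.Re e by rewrite -ltcR -eE.
  have d0 : 0 < complex.Re e / (nrm x + 1) by rewrite divr_gt0// ltr_wpDl ?nrm_ge0.
  have [A0 A0e] := tails _ d0; exists (psum T A0 x).
  exists A0 => // A /= A0A; rewrite -ball_normE /= nrmE eE ltcR nrmB.
  apply: le_lt_trans (A0e _ _ A0A) _; rewrite mulrAC ltr_pdivrMr.
    by rewrite ltr_pM2l// ltrDl.
  by rewrite ltr_wpDl ?nrm_ge0.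
pose S x : H := lim (psum T A x @[A --> summability.totally]).
have SE (e : R) : 0 < e -> exists A0, forall A x, (A0 `<=` A)%fset ->
    nrm (psum T A x - S x) <= e * nrm x.
  move=> e0; have e20 : 0 < e / 2 by rewrite divr_gt0.
  have [A0 A0e] := tails _ e20; exists A0 => A x A0A.
  apply/ler_addgt0Pr => d d0; have dC : 0 < d%:C by rewrite -[0]/(0%:C) ltcR.
  have /cvgrPdist_lt /(_ _ dC) [B0 _ B0d] := Tcvg x.
  have /= := B0d (A0 `|` B0)%fset (fsubsetUr _ _); rewrite nrmE ltcR -/(S x).
  set B := (A0 `|` B0)%fset => Bd.
  have -> : psum T A x - S x = (psum T A x - psum T A0 x) -
      (psum T B x - psum T A0 x) - (S x - psum T B x).
    by rewrite -[RHS]addrA opprB addrA subrKA opprB addrA subrK.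
  rewrite (le_trans (nrmD _ _))// nrmN lerD//; last exact: ltW.
  rewrite (le_trans (nrmD _ _))// nrmN [e]splitr mulrDl lerD//; apply: A0e => //.
  exact: fsubsetUl.
have lS : linear S.
  move=> a x y; rewrite [LHS]/S; apply: cvg_lim; first exact: norm_hausdorff.
  rewrite (_ : (fun A => _) = (fun A => a *: psum T A x + psum T A y)); last first.
    by apply/funext => A; have [lT _] := bpsum A; rewrite lT.
  by apply: cvgD; [apply: cvgZl_tmp|]; exact: Tcvg.
exists S; have bS : bounded_op S.
  apply/bounded_opP; split => //.
  have [A0 A0e] := SE 1 ltr01; exists (1 + opnorm (psum T A0)).
    by rewrite addr_ge0// opnorm_ge0.
  move=> x; rewrite mulrDl -(subrK (psum T A0 x) (S x)) (le_trans (nrmD _ _))//.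
  by rewrite lerD ?nrm_opnorm// nrmB A0e.
split => //; apply/cvgrPdist_le => e e0.
have [A0 A0e] := SE e e0; exists A0 => // A /= A0A.
rewrite sub0r normrN ger0_norm; last first.
  exact/opnorm_ge0/bounded_opD/bounded_opN.
apply: opnorm_le; first exact: ltW.
by move=> x; exact: A0e.
Qed.

End AbsoluteConvergence.

Section HolomorphicConvergence.
Context {R : realType} {k : nat} {n : 'I_k -> nat} (q : forall i, posreg R (n i)).
Implicit Types (F G : multiword n -> R[i]).

Definition energy_growth F (s M : R) :=
  forall p, energy q F p * s ^+ (2 * total_degree p) <= M.

Section AtPoint.
Context {H : hilbertType R} (X : forall i, 'I_(n i) -> H -> H).
Hypothesis DX : polydomain q X.

Let bX i j : bounded_op (@X i j).
Proof. by case: DX => -[]. Qed.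

(** Taking s^4 equal to the decay rate rho of the point leaves in the bound for the
    squared norm a factor s^(2|p|) for the growth of the energy and a factor s^(2|p|)
    for the convergence of the series. *)
Lemma hom_part_geometric : exists2 C : R, 0 <= C & exists2 s : R, 0 < s < 1 &
  forall F p x,
    nrm (hom_part F X p x) <= Num.sqrt (C * energy q F p) * nrm x /\
    forall M, energy_growth F s M ->
      nrm (hom_part F X p x) <= Num.sqrt (C * M) * s ^+ total_degree p * nrm x.
Proof.
have [C C0 [rho /andP[r0 r1] homC]] := polydomain_hom_part DX.
exists C => //; pose s := Num.sqrt (Num.sqrt rho).
have s0 : 0 < s by rewrite !sqrtr_gt0.
have s4 : s ^+ 4 = rho.
  by rewrite (exprM s 2 2) !sqr_sqrtr ?sqrtr_ge0// ltW.
have s1 : s < 1 by rewrite -(@ltr_pXn2r _ 4) ?nnegrE ?(ltW s0)// s4 expr1n.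
exists s; first by rewrite s0.
move=> F p x; have E0 := energy_ge0 q F p; have x0 := nrm_ge0 x.
split=> [|M FM].
  rewrite -(@ler_pXn2r _ 2) ?nnegrE ?nrm_ge0 ?mulr_ge0 ?sqrtr_ge0//.
  rewrite exprMn sqr_sqrtr ?mulr_ge0// (le_trans (homC F p x))//.
  rewrite ler_wpM2r ?sqr_ge0// ler_wpM2r// ler_piMr// exprn_ile1 ?(ltW r0)//.
  exact: ltW.
have M0 : 0 <= M by apply: le_trans (FM p); rewrite mulr_ge0// exprn_ge0// ltW.
have sp : 0 <= s ^+ total_degree p by rewrite exprn_ge0// ltW.
rewrite -(@ler_pXn2r _ 2) ?nnegrE ?nrm_ge0 ?mulr_ge0 ?sqrtr_ge0//.
rewrite !exprMn sqr_sqrtr ?mulr_ge0// (le_trans (homC F p x))//.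
have -> : rho ^+ total_degree p = s ^+ (2 * total_degree p) * (s ^+ total_degree p) ^+ 2.
  by rewrite -s4 -!exprM -exprD; congr (_ ^+ _); lia.
rewrite ler_wpM2r ?sqr_ge0// [C * (_ * _)]mulrA mulrAC ler_wpM2r ?sqr_ge0//.
by rewrite -mulrA ler_wpM2l// mulrC.
Qed.

Lemma geometric_bounded_psum (s K : R) : 0 < s < 1 -> 0 <= K ->
  bounded_psum (fun p : {ffun 'I_k -> nat} => K * s ^+ total_degree p).
Proof.
move=> /andP[s0 s1] K0; exists (K * (1 - s)^-1 ^+ k) => A.
by rewrite -mulr_sumr ler_wpM2l// geometric_multisum_le// ltW.
Qed.

Lemma energy_growth_converges F :
  (forall s, 0 < s < 1 -> exists M, energy_growth F s M) ->
  exists T, converges_to F X T.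
Proof.
move=> gF; have [C C0 [s s01 homC]] := hom_part_geometric.
have [M FM] := gF s s01; have /andP[s0 s1] := s01.
have [||||T [bT Tcvg]] := @operator_series_cvg R H _ (hom_part F X)
    (fun p => Num.sqrt (C * M) * s ^+ total_degree p).
- by move=> p; exact: hom_part_bounded.
- by move=> p; rewrite mulr_ge0 ?sqrtr_ge0// exprn_ge0// ltW.
- exact: geometric_bounded_psum.
- by move=> p x; have [_] := homC F p x; exact.
by exists T.
Qed.

Lemma converges_to_dist F G T S (M : R) : 0 <= M ->
  converges_to F X T -> converges_to G X S ->
  (forall (A : {fset {ffun 'I_k -> nat}}) x,
    nrm (\sum_(p <- A) hom_part (F - G) X p x) <= M * nrm x) ->
  opnorm (T - S) <= M.
Proof.
move=> M0 [bT /cvgrPdist_le FT] [bS /cvgrPdist_le GS] FGM.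
apply/ler_addgt0Pr => e e0; have e2 : 0 < e / 2 by rewrite divr_gt0.
have [A [/= AF AG]] := filter_ex (filterI (FT _ e2) (GS _ e2)).
have bF E : bounded_op (summability.partial_sum (hom_part E X) A).
  by rewrite psumE; apply: bounded_op_sum => p; exact: hom_part_bounded.
move: AF AG; rewrite !sub0r !normrN => /(le_trans (ler_norm _)) AF /(le_trans (ler_norm _)) AG.
apply: opnorm_le => [|x]; first by rewrite addr_ge0// ltW.
have -> : (T - S) x = \sum_(p <- A) hom_part (F - G) X p x
    - (summability.partial_sum (hom_part F X) A - T) x
    + (summability.partial_sum (hom_part G X) A - S) x.
  have -> : \sum_(p <- A) hom_part (F - G) X p x =
      summability.partial_sum (hom_part F X) A x -
      summability.partial_sum (hom_part G X) A x.
    rewrite !psumE !fct_sumE -sumrB; apply: eq_bigr => p _.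
    rewrite !hom_partE -sumrB; apply: eq_bigr => w _.
    by rewrite !fctE scalerBl.
  move: (summability.partial_sum _ _) (summability.partial_sum _ _) => Q P.
  rewrite -[LHS]/(T x - S x) -[RHS]/(P x - Q x - (P x - T x) + (Q x - S x)).
  by rewrite opprB [X in X + (_ - S x)]addrC !subrKA.
rewrite (le_trans (nrmD _ _))// mulrDl [e]splitr mulrDl addrA lerD//.
  rewrite (le_trans (nrmD _ _))// lerD// nrmN.
  rewrite (le_trans (nrm_opnorm _ _)) ?ler_wpM2r ?nrm_ge0//.
  exact/bounded_opD/bounded_opN.
rewrite (le_trans (nrm_opnorm _ _)) ?ler_wpM2r ?nrm_ge0//.
exact/bounded_opD/bounded_opN.
Qed.

(** Dominated convergence: finitely many multidegrees carry all but a small part of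
    the dominating series, and on these the energies tend to zero. *)
Lemma dominated_evaluation (F : nat -> multiword n -> R[i]) G T S :
  (forall l, converges_to (F l) X (T l)) -> converges_to G X S ->
  (forall p, energy q (F l - G) p @[l --> \oo] --> (0 : R)) ->
  (forall s, 0 < s < 1 -> exists M, forall l, energy_growth (F l - G) s M) ->
  opnorm (T l - S) @[l --> \oo] --> (0 : R).
Proof.
move=> FT GS Ecvg gFG; have [C C0 [s s01 homC]] := hom_part_geometric.
have [M FM] := gFG s s01; have /andP[s0 s1] := s01.
apply/cvgrPdist_le => e e0; have e2 : 0 < e / 2 by rewrite divr_gt0.
pose u (p : {ffun 'I_k -> nat}) := Num.sqrt (C * M) * s ^+ total_degree p.
have u0 p : 0 <= u p.
  by rewrite mulr_ge0 ?sqrtr_ge0// exprn_ge0// ltW.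
have bu : bounded_psum u by exact: geometric_bounded_psum.
have [A0 A0e] := small_tails u0 bu e2.
have : \sum_(p <- A0) Num.sqrt (C * energy q (F l - G) p) @[l --> \oo] -->
    \sum_(p <- A0) (0 : R).
  apply: cvg_big => [|p _]; first exact: add_continuous.
  have /(continuous_cvg _ (@sqrt_continuous R _)) :
      C * energy q (F l - G) p @[l --> \oo] --> C * 0 by exact: cvgMr.
  by rewrite mulr0 sqrtr0.
rewrite big1 => // /cvgrPdist_le /(_ _ e2) [N _ N_le].
exists N => // l /N_le /=; rewrite !sub0r !normrN => /(le_trans (ler_norm _)) lN.
have [bT _] := FT l; have [bS _] := GS.
rewrite ger0_norm; last exact/opnorm_ge0/bounded_opD/bounded_opN.
apply: (converges_to_dist (ltW e0) (FT l) GS) => A x.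
apply: (le_trans (nrm_sum _ _)).
rewrite (big_fsetID _ (mem A0) A)/= [e]splitr mulrDl lerD//.
  apply: (@le_trans _ _ (\sum_(p <- [fset p in A | p \in A0]%fset)
      Num.sqrt (C * energy q (F l - G) p) * nrm x)).
    by apply: ler_sum => p _; have [] := homC (F l - G) p x.
  rewrite -mulr_suml ler_wpM2r ?nrm_ge0// (le_trans _ lN)//.
  apply: ler_sum_uniq => [|p|p]; rewrite ?fset_uniq ?sqrtr_ge0//.
  by rewrite !inE => /andP[].
apply: (@le_trans _ _ (\sum_(p <- [fset p in A | p \notin A0]%fset) u p * nrm x)).
  by apply: ler_sum => p _; have [_ /(_ _ (FM l))] := homC (F l - G) p x.
rewrite -mulr_suml ler_wpM2r ?nrm_ge0// A0e//.
by apply/fdisjointP => p pA; rewrite !inE/= pA andbF.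
Qed.

End AtPoint.
End HolomorphicConvergence.

(** * Diagonal operators on sequence spaces *)

Section SequenceSpace.
Context {R : realType} {I : choiceType}.
Local Notation C := R[i].
Local Notation Re := complex.Re.
Local Notation Im := complex.Im.
Implicit Types (f g : l2 R I) (d : I -> R) (T : l2 R I -> l2 R I).

Lemma rsum_single (x : I -> R) i : (forall l, l != i -> x l = 0) -> rsum x = x i.
Proof.
move=> x0; apply: cvg_lim => //; apply: cvg_near_cst.
exists [fset i]%fset => // A /= iA; rewrite psumE.
have {}iA : i \in A by apply: (fsubsetP iA); rewrite inE.
rewrite (perm_big _ (perm_to_rem iA))/= big_cons big_seq big1 ?addr0// => l.
by rewrite mem_rem_uniq ?fset_uniq// inE => /andP[/x0].
Qed.

(** Coordinates are inner products, so an adjoint on a sequence space can be read off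
    from the images of the basis vectors. *)
Lemma hdot_l2delta f i : hdot f (l2delta i) = f i.
Proof.
rewrite -[LHS]/(l2dot f (l2delta i)) /l2dot.
rewrite !(@rsum_single _ i) => [|l /negbTE li|l /negbTE li].
- by rewrite /= eqxx; case: (f i) => a b; apply/eqP; rewrite eq_complex /=; apply/andP; split; apply/eqP; ring.
- by rewrite /= li; case: (f l) => a b /=; ring.
- by rewrite /= li; case: (f l) => a b /=; ring.
Qed.

Lemma l2_sum (J : Type) (s : seq J) (F : J -> l2 R I) i :
  (\sum_(j <- s) F j) i = \sum_(j <- s) F j i.
Proof. by elim/big_rec2: _ => // j x f _ <-. Qed.

Lemma sqnorm_nrm f : sqnorm f = nrm f ^+ 2.
Proof. by rewrite /nrm l2_normE /= sqr_sqrtr// sqnorm_ge0. Qed.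

Definition acts_diagonally T d := forall f i, T f i = (d i)%:C * f i.

Lemma sqabs_real_mul (a : R) (z : C) : sqabs (a%:C * z) = a ^+ 2 * sqabs z.
Proof. by case: z => x y; rewrite /sqabs/=; ring. Qed.

Lemma diagonal_bounded T d (M : R) : acts_diagonally T d ->
  (forall i, `|d i| <= M) -> bounded_op T.
Proof.
move=> Td dM; apply/bounded_opP; split=> [a f g|].
  by apply: l2_eq => i; rewrite l2D l2Z !Td l2D l2Z mulrDr mulrCA.
exists `|M| => // f; rewrite -(@ler_pXn2r _ 2) ?nnegrE ?nrm_ge0 ?mulr_ge0 ?nrm_ge0//.
rewrite exprMn -!sqnorm_nrm; apply: sqnorm_lub => A.
rewrite (le_trans _ (ler_wpM2l _ (sqnorm_ub f A))) ?sqr_ge0// mulr_sumr.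
apply: ler_sum => i _; rewrite Td sqabs_real_mul ler_wpM2r ?sqabs_ge0//.
rewrite -[d i ^+ 2]real_normK ?num_real// ler_pXn2r ?nnegrE//.
exact: le_trans (dM i) (ler_norm _).
Qed.

Lemma diagonal_positive T d (M : R) : acts_diagonally T d ->
  0 <= M -> (forall i, 0 <= d i <= M) -> positive_op T.
Proof.
move=> Td M0 dM; split.
  by apply: (diagonal_bounded (M := M) Td) => i; have /andP[d0 dM'] := dM i; rewrite ger0_norm.
move=> f; rewrite -[hdot _ _]/(l2dot (T f) f) /l2dot.
rewrite (_ : (fun i => Re _) = (fun i => d i * sqabs (f i))); last first.
  by apply/funext => i; rewrite Td; case: (f i) => x y; rewrite /sqabs/=; ring.
rewrite (_ : (fun i => Im _) = (fun i => 0 * sqabs (f i) + 0 * sqabs (f i))); last first.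
  by apply/funext => i; rewrite Td; case: (f i) => x y; rewrite /sqabs/=; ring.
have d0 i : 0 <= d i * sqabs (f i).
  by have /andP[d0 _] := dM i; rewrite mulr_ge0 ?sqabs_ge0.
have bs : bounded_psum (fun i => d i * sqabs (f i)).
  exists (M * sqnorm f) => A; rewrite (@le_trans _ _ (\sum_(i <- A) M * sqabs (f i)))//.
    apply: ler_sum => i _; have /andP[_ dM'] := dM i.
    by rewrite ler_wpM2r ?sqabs_ge0.
  by rewrite -mulr_sumr ler_wpM2l ?sqnorm_ub.
have := (rsum_ge0E d0 bs).1 fset0; rewrite big_seq_fset0 => r0.
have sa : abs_summable (fun i => sqabs (f i)).
  exists (sqnorm f) => A; rewrite (le_trans _ (sqnorm_ub f A))//.
  by apply: ler_sum => i _; rewrite ger0_norm ?sqabs_ge0.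
by rewrite rsum_lin// !mul0r addr0 lecE /= eqxx.
Qed.

Lemma diag_mem d (M : R) f : (forall i, `|d i| <= M) ->
  (fun i => (d i)%:C * f i) \in @l2_pred R I.
Proof.
move=> dM; apply/asboolP; exists (M ^+ 2 * sqnorm f) => A.
rewrite (le_trans _ (ler_wpM2l _ (sqnorm_ub f A))) ?sqr_ge0// mulr_sumr.
apply: ler_sum => i _; rewrite sqabs_real_mul ler_wpM2r ?sqabs_ge0//.
rewrite -[d i ^+ 2]real_normK ?num_real// ler_pXn2r ?nnegrE//.
exact: le_trans (normr_ge0 (d i)) (dM i).
Qed.

Lemma diagonal_invertible T d (c : R) : acts_diagonally T d -> 0 < c ->
  (forall i, c <= d i) -> invertible_op T.
Proof.
move=> Td c0 cd.
have d0 i : d i != 0 by rewrite gt_eqF// (lt_le_trans c0).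
have dM i : `|(d i)^-1| <= c^-1.
  have di0 := lt_le_trans c0 (cd i).
  by rewrite ger0_norm ?invr_ge0 ?(ltW di0)// lef_pV2 ?posrE.
pose S f : l2 R I := L2 (diag_mem f dM).
have Sd : acts_diagonally S (fun i => (d i)^-1) by [].
exists S; split; first exact: diagonal_bounded Sd dM.
  apply/funext => f; apply: l2_eq => i.
  by rewrite /= Td mulrA -rmorphM /= mulVf// mul1r.
apply/funext => f; apply: l2_eq => i.
by rewrite /= Td Sd mulrA -rmorphM /= divff// mul1r.
Qed.

End SequenceSpace.

(** * The scaled universal model *)

Section ScaledModel.
Context {R : realType} {k : nat} {n : 'I_k -> nat} (q : forall i, posreg R (n i)).
Variable r : R.
Hypothesis r01 : 0 <= r < 1.
Local Notation tensor := (l2 R (multiword n)).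
Local Notation C := R[i].
Local Notation X := (scaled_model q r).
Local Notation Re := complex.Re.
Implicit Types (f : tensor) (b w : multiword n) (s : seq 'I_k).

Let r0 : 0 <= r. Proof. by case/andP: r01. Qed.

Lemma subst_wordK b i : subst_word b (b i) = b.
Proof.
apply/ffunP => l; have [<-|il] := eqVneq i l; first by rewrite subst_word_in.
by rewrite subst_word_out.
Qed.

Lemma subst_word_subst b i (u v : seq 'I_(n i)) :
  subst_word (subst_word b u) v = subst_word b v.
Proof.
apply/ffunP => l; have [<-|il] := eqVneq i l; first by rewrite !subst_word_in.
by rewrite !subst_word_out.
Qed.

Lemma subst_wordC b i l (u : seq 'I_(n i)) (v : seq 'I_(n l)) : i != l ->
  subst_word (subst_word b u) v = subst_word (subst_word b v) u.
Proof.
move=> il; apply/ffunP => m; have [im|im] := eqVneq i m.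
  by rewrite -im subst_word_in subst_word_out ?subst_word_in// eq_sym.
rewrite (subst_word_out _ _ im); have [lm|lm] := eqVneq l m.
  by rewrite -lm !subst_word_in.
by rewrite !subst_word_out.
Qed.

Lemma stripE m (j : 'I_m) u v : strip j u = Some v -> u = j :: v.
Proof. by case: u => //= h t; case: eqP => // -> [->]. Qed.

Lemma scaled_modelE i (j : 'I_(n i)) f b : X j f b =
  if strip j (b i) is Some v then
    (r * Num.sqrt (weight (q i) v / weight (q i) (b i)))%:C * f (subst_word b v)
  else 0.
Proof.
rewrite -[LHS]/(r%:C * model_fun q j f b) /model_fun /= /shift_fun.
case E : (strip j (b i)) => [v|]; last by rewrite mulr0.
by rewrite (stripE E) rmorphM mulrA.
Qed.


Lemma scaled_model_bounded i j : bounded_op (@X i j).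
Proof. exact/bounded_opZ/model_bounded. Qed.

Lemma scaled_modelC i l (j : 'I_(n i)) (h : 'I_(n l)) : i != l ->
  X j \o X h = X h \o X j.
Proof.
move=> il; apply/funext => f; apply: l2_eq => b.
rewrite -[LHS]/(X j (X h f) b) -[RHS]/(X h (X j f) b) !scaled_modelE.
case Ei : (strip j (b i)) => [v|]; case El : (strip h (b l)) => [u|] //;
  rewrite ?scaled_modelE ?subst_word_out ?[l == i]eq_sym // ?Ei ?El ?mulr0 //.
by rewrite mulrCA subst_wordC.
Qed.

#[local] Hint Extern 0 (is_true (_ < weight _ _)) => exact: weight_gt0 : core.

Let sqrt_ratio (x y z : R) : 0 < x -> 0 < y -> 0 < z ->
  Num.sqrt (y / x) * Num.sqrt (z / y) = Num.sqrt (z / x).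
Proof.
move=> x0 y0 z0; rewrite -sqrtrM ?divr_ge0 ?ltW//; congr Num.sqrt.
by field; rewrite !gt_eqF.
Qed.

Lemma word_op_modelE i (u : seq 'I_(n i)) f b : word_op (@X i) u f b =
  if prefix u (b i) then
    (r ^+ size u * Num.sqrt (weight (q i) (drop (size u) (b i)) / weight (q i) (b i)))%:C
      * f (subst_word b (drop (size u) (b i)))
  else 0.
Proof.
elim: u f b => [|j u IHu] f b.
  rewrite prefix0s drop0 divff ?gt_eqF//.
  by rewrite sqrtr1 expr0 mul1r rmorph1 mul1r subst_wordK.
rewrite -[LHS]/(X j (word_op (@X i) u f) b) scaled_modelE.
case E : (strip j (b i)) => [v|]; last first.
  case: ifP => // /prefixP[v bv]; move: E; rewrite bv /= eqxx.
  by [].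
rewrite IHu subst_word_in (stripE E) /= eqxx/=.
case: ifP => _; last by rewrite mulr0.
rewrite subst_word_subst mulrA -rmorphM exprS.
rewrite -(@sqrt_ratio (weight (q i) (j :: v)) (weight (q i) v) (weight (q i) (drop (size u) v)))//.
by rewrite mulrACA.
Qed.

Lemma word_op_model_delta i (u : seq 'I_(n i)) w :
  word_op (@X i) u (l2delta w) =
  (r ^+ size u * Num.sqrt (weight (q i) (w i) / weight (q i) (u ++ w i)))%:C *:
    l2delta (subst_word w (u ++ w i)).
Proof.
apply: l2_eq => b; rewrite word_op_modelE l2Z /=.
have [->|/eqP bw] := eqVneq b (subst_word w (u ++ w i)).
  by rewrite subst_word_in prefix_prefix drop_size_cat// subst_word_subst subst_wordK eqxx.
case: ifP => [/prefixP[v bv]|]; last by rewrite mulr0.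
case: eqP => [E|]; last by rewrite !mulr0.
case: bw; rewrite -E subst_word_in subst_word_subst.
by rewrite bv drop_size_cat// -bv subst_wordK.
Qed.

(** The coordinate at w is the inner product with the image of the basis vector at
    w. *)
Lemma adjoint_word_modelE i (u : seq 'I_(n i)) f w :
  adjoint (word_op (@X i) u) f w =
  (r ^+ size u * Num.sqrt (weight (q i) (w i) / weight (q i) (u ++ w i)))%:C *
    f (subst_word w (u ++ w i)).
Proof.
rewrite -hdot_l2delta adjointP'; last first.
  by apply: word_op_bounded => j; exact: scaled_model_bounded.
by rewrite word_op_model_delta hdotZr hdot_l2delta conj_Creal// complex_real.
Qed.

(** The factor by which Phi multiplies the entries of a diagonal operator whose
    entries do not depend on the i-th word. *)
Definition Phi_weight i (t : seq 'I_(n i)) : R :=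
  \sum_(u <- finsupp (q i) | prefix u t)
    q i u * (r ^+ size u) ^+ 2 * (weight (q i) (drop (size u) t) / weight (q i) t).

(** By the recursion for the weights, the sum without the powers of r is 1 when t is
    nonempty; every u in the support of q is nonempty and so contributes a factor at
    most r^2. When t is empty the sum vanishes. *)
Lemma Phi_weight_bounds i (t : seq 'I_(n i)) : 0 <= Phi_weight t <= r ^+ 2.
Proof.
have term_ge0 (u : seq 'I_(n i)) : 0 <= weight (q i) (drop (size u) t) / weight (q i) t.
  by rewrite divr_ge0// ltW.
apply/andP; split.
  apply: sumr_ge0 => u _; apply: mulr_ge0 _ (term_ge0 u).
  by apply: mulr_ge0; [exact: coef_ge0|exact: sqr_ge0].
have [->|t0] := eqVneq t [::].
  rewrite /Phi_weight big1 ?sqr_ge0// => u; rewrite prefixs0 => /eqP ->.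
  by rewrite coef_nil !mul0r.
rewrite (@le_trans _ _ (\sum_(u <- finsupp (q i) | prefix u t)
    r ^+ 2 * (q i u * (weight (q i) (drop (size u) t) / weight (q i) t))))//.
  apply: ler_sum => u _; have [->|u0] := eqVneq u [::].
    by rewrite coef_nil !mul0r mulr0.
  rewrite [leRHS]mulrA ler_wpM2r// mulrC ler_wpM2r ?coef_ge0//.
  rewrite -exprM mulnC exprM -[leRHS]expr1 ler_wiXn2l ?sqr_ge0 ?lt0n ?size_eq0//.
  by rewrite exprn_ile1// ltW//; case/andP: r01.
rewrite -mulr_sumr ler_piMr ?sqr_ge0//.
under eq_bigr do rewrite mulrA.
rewrite -mulr_suml ler_pdivrMr// mul1r weight_rec//.
rewrite (_ : \sum_(1 <= l < _) _ = \sum_(u <- [seq take l t | l <- iota 1 (size t)])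
    q i u * weight (q i) (drop (size u) t)); last first.
  rewrite big_map /index_iota subn1 big_seq [RHS]big_seq.
  apply: eq_bigr => l; rewrite mem_iota add1n ltnS => /andP[_ lt].
  by rewrite size_take_min (minn_idPl lt).
rewrite big_mkcond (bigID (fun u => (u != [::]) && prefix u t))/=.
rewrite [X in _ + X]big1 ?addr0; last first.
  move=> u; rewrite negb_and negbK => /orP[/eqP ->|/negbTE ->//].
  by rewrite coef_nil mul0r if_same.
rewrite (eq_bigr (fun u => q i u * weight (q i) (drop (size u) t))); last first.
  by move=> u /andP[_ ->].
rewrite -big_filter; apply: ler_sum_uniq.
- by rewrite filter_uniq.
- move=> u; rewrite mem_filter => /andP[/andP[u0 ut] _]; apply/mapP.
  exists (size u); last by apply/eqP; rewrite eq_sym -prefixE.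
  by rewrite mem_iota add1n ltnS size_prefix// andbT lt0n size_eq0.
- by move=> u; rewrite mulr_ge0 ?coef_ge0// ltW.
Qed.

Lemma diagonal_sub_Phi i (T : tensor -> tensor) (d : multiword n -> R) :
  acts_diagonally T d ->
  (forall b (v : seq 'I_(n i)), d (subst_word b v) = d b) ->
  acts_diagonally (T - Phi (q i) (@X i) T) (fun b => (1 - Phi_weight (b i)) * d b).
Proof.
move=> Td di f b.
suff E : Phi (q i) (@X i) T f b = (Phi_weight (b i) * d b)%:C * f b.
  rewrite fctE l2D l2N E Td -mulrBl -rmorphB; congr (_%:C * _).
  by rewrite mulrBl mul1r.
rewrite /Phi fct_sumE l2_sum /Phi_weight mulr_suml rmorph_sum mulr_suml.
rewrite [RHS]big_mkcond.
apply: eq_bigr => u _; rewrite fctE l2Z /= word_op_modelE.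
case: ifP => [/prefixP[v bv]|_]; last by rewrite mulr0.
rewrite Td di adjoint_word_modelE subst_word_in subst_word_subst bv drop_size_cat//.
set a := Num.sqrt _.
have -> : weight (q i) v / weight (q i) (u ++ v) = a ^+ 2.
  by rewrite sqr_sqrtr// divr_ge0// ltW.
clearbody a; rewrite -bv subst_wordK !mulrA -!rmorphM; congr (_ * _).
by congr (_%:C); ring.
Qed.

Let Delta_weight (p : 'I_k -> bool) s b : R :=
  \prod_(i <- s) (if p i then 1 - Phi_weight (b i) else 1).

Let Delta_diagonal (p : 'I_k -> bool) s : uniq s ->
  acts_diagonally ((\big[comp/id]_(i <- s)
    iter (p i) (fun Y : tensor -> tensor => Y - Phi (q i) (@X i) Y)) id) (Delta_weight p s).
Proof.
rewrite /Delta_weight; elim: s => [_|i s IHs /= /andP[is_ us]].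
  by move=> f b; rewrite !big_nil mul1r.
have {IHs} := IHs us; rewrite big_cons /=; move: (\big[_/_]_(_ <- s) _) => T.
case pi : (p i) => /= Td.
  move=> f b; rewrite big_cons pi; apply: (diagonal_sub_Phi Td) => {}b v.
  rewrite big_seq [RHS]big_seq; apply: eq_bigr => l ls.
  by rewrite subst_word_out//; apply: contraNneq is_ => ->.
by move=> f b; rewrite big_cons pi mul1r.
Qed.

Let r2 : 0 < 1 - r ^+ 2.
Proof. by case/andP: r01 => _ r1; rewrite subr_gt0 expr_lt1. Qed.

Let factor_bounds (p : 'I_k -> bool) b i :
  1 - r ^+ 2 <= (if p i then 1 - Phi_weight (b i) else 1) <= 1.
Proof.
have /andP[P0 P1] := Phi_weight_bounds (b i).
by case: (p i); rewrite ?lexx ?andbT ?gerBl ?sqr_ge0// lerD2l lerN2 P1.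
Qed.

(** The operators Delta^p(I) are diagonal with entries products of factors between
    1 - r^2 and 1. *)
Lemma scaled_model_polydomain : polydomain q X.
Proof.
have Dd p := Delta_diagonal p (index_enum_uniq 'I_k).
have D01 p b : 0 <= Delta_weight p (index_enum 'I_k) b <= 1.
  apply/andP; split.
    apply: prodr_ge0 => i _; have /andP[h _] := factor_bounds p b i.
    exact: le_trans (ltW r2) h.
  apply: prodr_ile1 => i _; have /andP[h1 h2] := factor_bounds p b i.
  by rewrite h2 andbT (le_trans (ltW r2)).
have Dp p : positive_op (Delta q p X id) by exact: diagonal_positive (Dd p) ler01 (D01 p).
split => //; first by split; [exact: scaled_model_bounded|move=> i l il j h; exact: scaled_modelC|].
apply: (diagonal_invertible (c := (1 - r ^+ 2) ^+ k) (Dd xpredT)); first exact: exprn_gt0.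
move=> b; rewrite (_ : (1 - r ^+ 2) ^+ k = \prod_(i < k) (1 - r ^+ 2)); last first.
  by rewrite big_const_ord iter_mulr_1.
apply: ler_prod => i _; have /andP[h1 h2] := factor_bounds xpredT b i.
by rewrite (ltW r2) h1.
Qed.

End ScaledModel.

(** * Coefficients of an evaluation at the scaled model *)

Section VacuumVector.
Context {R : realType} {k : nat} {n : 'I_k -> nat} (q : forall i, posreg R (n i)).
Variable r : R.
Local Notation tensor := (l2 R (multiword n)).
Local Notation rW := (scaled_model q r).
Implicit Types (w : multiword n) (s : seq 'I_k) (p : {ffun 'I_k -> nat}).

Let vacuum : tensor := l2delta (@empty_multiword k n).

Let coefficient w : R :=
  \prod_i (r ^+ size (w i) * Num.sqrt (weight (q i) (w i))^-1).

Lemma multiword_op_vacuum w :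
  multiword_op rW w vacuum = (coefficient w)%:C *: l2delta w.
Proof.
pose restr s : multiword n := [ffun i => if i \in s then w i else [::]].
suff E s : uniq s -> (\big[comp/id]_(i <- s) word_op (@rW i) (w i)) vacuum =
    (\prod_(i <- s) (r ^+ size (w i) * Num.sqrt (weight (q i) (w i))^-1))%:C *:
      l2delta (restr s).
  rewrite /multiword_op E ?index_enum_uniq//; congr (_ *: l2delta _).
  by apply/ffunP => i; rewrite ffunE mem_index_enum.
elim: s => [_|i s IHs /= /andP[is_ us]].
  by rewrite !big_nil scale1r.
have [lX _] : bounded_op (word_op (@rW i) (w i)).
  by apply: word_op_bounded => j; exact: scaled_model_bounded.
rewrite !big_cons /= IHs// (linear_opZ lX) word_op_model_delta scalerA.
rewrite -rmorphM {2 3 4}/restr ffunE (negbTE is_) cats0 weight_nil mul1r mulrC.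
congr (_ *: l2delta _); apply/ffunP => l; rewrite [RHS]ffunE inE.
have [->|li] := eqVneq l i; first by rewrite subst_word_in.
by rewrite subst_word_out ?ffunE// eq_sym.
Qed.

Lemma sqabs_coefficient w p : (forall i, size (w i) = p i) ->
  coefficient w ^+ 2 = r ^+ (2 * total_degree p) / mweight q w.
Proof.
move=> wp; rewrite /coefficient /mweight /total_degree -prodrXl -prodfV mulnC exprM.
rewrite expr_sum -prodrXl -big_split; apply: eq_bigr => i _ /=.
by rewrite exprMn sqr_sqrtr ?wp// invr_ge0 ltW// weight_gt0.
Qed.

Let nrm_vacuum : nrm vacuum = 1.
Proof.
have : (nrm vacuum ^+ 2)%:C = 1 by rewrite -hdotxx hdot_l2delta /= eqxx.
move=> /complexI/eqP; rewrite sqrp_eq1 ?nrm_ge0// => /eqP.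
exact.
Qed.

(** The basis vector at w occurs only in the part of multidegree p, so this
    coordinate is constant along the partial sums whose index set contains p. *)
Lemma eval_vacuum_coord F T w : converges_to F rW T ->
  T vacuum w = F w * (coefficient w)%:C.
Proof.
move=> [bT /cvgrPdist_le FT].
pose p : {ffun 'I_k -> nat} := [ffun i => size (w i)].
have coordE A : p \in A -> summability.partial_sum (hom_part F rW) A vacuum w =
    F w * (coefficient w)%:C.
  move=> pA; rewrite psumE fct_sumE l2_sum.
  rewrite (perm_big _ (perm_to_rem pA))/= big_cons [X in _ + X]big1_seq ?addr0.
    rewrite hom_partE l2_sum.
    have wp : w \in multidegree_seq p.
      by rewrite mem_multidegree_seq; apply/asboolP => i; rewrite ffunE.
    rewrite (perm_big _ (perm_to_rem wp))/= big_cons [X in _ + X]big1_seq ?addr0.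
      rewrite multiword_op_vacuum.
      by rewrite -[LHS]/(F w * ((coefficient w)%:C * (w == w)%:R)) eqxx mulr1.
    move=> w' /andP[_]; rewrite mem_rem_uniq ?fset_uniq// inE => /andP[/negbTE w'w _].
    rewrite multiword_op_vacuum.
    rewrite -[LHS]/(F w' * ((coefficient w')%:C * (w == w')%:R)).
    by rewrite eq_sym w'w !mulr0.
  move=> p' /andP[_]; rewrite mem_rem_uniq ?fset_uniq// inE => /andP[/eqP p'p _].
  rewrite hom_partE l2_sum big1_seq// => w' /andP[_].
  rewrite mem_multidegree_seq => /asboolP w'p'.
  rewrite multiword_op_vacuum -[LHS]/(F w' * ((coefficient w')%:C * (w == w')%:R)).
  case: eqP => [ww'|_]; last by rewrite !mulr0.
  by case: p'p; apply/ffunP => i; rewrite ffunE ww' w'p'.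
apply/eqP; rewrite -subr_eq0; apply/eqP/nrm_eq0/eqP.
rewrite eq_le nrm_ge0 andbT; apply/ler_addgt0Pr => e e0; rewrite add0r.
have [A0 _ A0e] := FT e e0.
have pA : p \in (A0 `|` [fset p])%fset by rewrite !inE eqxx orbT.
have := A0e (A0 `|` [fset p])%fset (fsubsetUl _ _).
rewrite /= sub0r normrN => /(le_trans (ler_norm _)).
rewrite -(coordE _ pA); set P := summability.partial_sum _ _ => Pe.
have bP : bounded_op (P - T).
  apply: bounded_opD; last exact: bounded_opN.
  rewrite /P psumE; apply: bounded_op_sum => p'; apply: hom_part_bounded => i j.
  exact: scaled_model_bounded.
apply: le_trans Pe; have := nrm_opnorm vacuum bP; rewrite nrm_vacuum mulr1.
apply: le_trans; rewrite nrmB -(@ler_pXn2r _ 2) ?nnegrE ?nrm_ge0//.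
rewrite -sqabs_nrm -sqnorm_nrm; exact: (sqabs_le_sqnorm ((P - T) vacuum) w).
Qed.

Lemma energy_le_opnorm F T p : converges_to F rW T ->
  energy q F p * r ^+ (2 * total_degree p) <= opnorm T ^+ 2.
Proof.
move=> FT; have [bT _] := FT.
apply: (@le_trans _ _ (nrm (T vacuum) ^+ 2)); last first.
  have := nrm_opnorm vacuum bT; rewrite nrm_vacuum mulr1 => h.
  by rewrite ler_pXn2r ?nnegrE ?nrm_ge0// opnorm_ge0.
rewrite -sqnorm_nrm; apply: le_trans (sqnorm_ub _ (fset_set (multidegree p))).
rewrite /energy mulr_suml le_eqVlt; apply/orP; left; apply/eqP.
rewrite big_seq [RHS]big_seq; apply: eq_bigr => w.
rewrite -/(multidegree_seq p) mem_multidegree_seq => /asboolP wp.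
rewrite (eval_vacuum_coord w FT) mulrC [in RHS]mulrC sqabs_real_mul.
by rewrite (sqabs_coefficient wp) mulrA mulrAC.
Qed.

End VacuumVector.

Section Subsequence.
Context {R : realType}.
Local Notation C := R[i].
Local Notation Re := complex.Re.
Local Notation Im := complex.Im.

(** A cluster point of an ultrafilter is a limit. *)
Lemma ultra_bounded_cvg (U : set_system nat) (x : nat -> R) (B : R) :
  UltraFilter U -> (forall m, `|x m| <= B) -> exists a : R, x m @[m --> U] --> a.
Proof.
move=> UU xB.
have [|a [_ xa]] := @segment_compact R (- B) B (x @ U) _.
  by apply: (@filterE _ U) => m /=; rewrite in_itv/= -ler_norml xB.
exists a => N aN; have [//|UN] := in_ultra_setVsetC (x @^-1` N) UU.
by have [y [yN]] := xa (~` N) N UN aN.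
Qed.

Lemma nrm_le_ReIm (z : C) : nrm z <= `|Re z| + `|Im z|.
Proof.
rewrite -(@ler_pXn2r _ 2) ?nnegrE ?nrm_ge0 ?addr_ge0//.
rewrite -sqabs_nrm /sqabs sqrrD !real_normK ?num_real// -addrAC.
by rewrite lerDl mulrn_wge0// mulr_ge0.
Qed.

(** All coordinates converge along one ultrafilter finer than the neighbourhoods of
    infinity. Its sets are closed under finite intersection and unbounded, which
    yields indices, as large as wanted, at which finitely many coordinates are
    simultaneously close to their limits. *)
Lemma diagonal_subsequence (I : countType) (g : nat -> I -> C) :
  (forall i, exists B : R, forall m, nrm (g m i) <= B) ->
  exists2 phi : nat -> nat, {homo phi : l m / (l < m)%N} &
  exists F : I -> C, forall i, nrm (g (phi l) i - F i) @[l --> \oo] --> (0 : R).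
Proof.
move=> gB; have [U [UU sU]] := @ultraFilterLemma nat \oo _.
have lim_i i : exists z : C, forall e : R, 0 < e -> U [set m | nrm (g m i - z) < e].
  have [B iB] := gB i.
  have [m|a Ua] := @ultra_bounded_cvg U (fun m => Re (g m i)) B UU.
    by rewrite (le_trans _ (iB m))// ler_norml Re_le_nrm lerNl -ReN -nrmN Re_le_nrm.
  have [m|b Ub] := @ultra_bounded_cvg U (fun m => Im (g m i)) B UU.
    rewrite (le_trans _ (iB m))// -(@ler_pXn2r _ 2) ?nnegrE ?nrm_ge0//.
    by rewrite -sqabs_nrm /sqabs real_normK ?num_real// lerDr sqr_ge0.
  exists (a +i* b) => e e0; have e2 : 0 < e / 2 by rewrite divr_gt0.
  have /cvgrPdist_lt /(_ _ e2) Ua' := Ua; have /cvgrPdist_lt /(_ _ e2) Ub' := Ub.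
  apply: filterS2 Ua' Ub' => m /= am bm.
  apply: le_lt_trans (nrm_le_ReIm _) _; rewrite [e]splitr.
  by move: am bm; rewrite (distrC a) (distrC b); case: (g m i) => x y /=; exact: ltrD.
have /choice[F FU] := lim_i.
have next N l : exists m, (N < m)%N /\ forall j i, (j < l)%N ->
    choice.unpickle j = Some i -> nrm (g m i - F i) < l.+1%:R^-1.
  have l0 : 0 < l.+1%:R^-1 :> R by rewrite invr_gt0.
  have UN : U [set m | (N < m)%N] by apply: sU; exists N.+1.
  have Ul : U [set m | forall j : 'I_l, forall i, choice.unpickle j = Some i ->
      nrm (g m i - F i) < l.+1%:R^-1].
    apply: filter_forall => j; case: (choice.unpickle j) => [i|]; last by apply: filterE.
    by apply: filterS (FU i _ l0) => m mi _ [<-].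
  have [m [Nm ml]] := filter_ex (filterI UN Ul).
  by exists m; split => // j i jl; exact: (ml (Ordinal jl)).
have /choice[nx nxP] : forall Nl : nat * nat, exists m, (Nl.1 < m)%N /\
    forall j i, (j < Nl.2)%N -> choice.unpickle j = Some i -> nrm (g m i - F i) < Nl.2.+1%:R^-1.
  by move=> [N l]; exact: next.
pose phi := fix phi l := if l is l'.+1 then nx (phi l', l'.+1) else nx (0, 0)%N.
exists phi.
  by apply: homo_ltn => [a b c|l]; [exact: ltn_trans|have [] := nxP (phi l, l.+1)].
exists F => i; apply/cvgrPdist_lt => e e0.
have [N Ne] : exists N : nat, N.+1%:R^-1 < e.
  by have [N _ /(_ N (leqnn _))] := near_infty_natSinv_lt (PosNum e0); exists N.
exists (maxn N (choice.pickle i)).+1 => // -[//|l] /=; rewrite ltnS geq_max => /andP[Nl il].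
rewrite sub0r normrN ger0_norm ?nrm_ge0//.
have [_ /(_ (choice.pickle i) i)] := nxP (phi l, l.+1); rewrite /= ltnS choice.pickleK => /(_ il erefl).
move=> /lt_trans; apply; apply: le_lt_trans Ne.
by rewrite lef_pV2 ?posrE ?ltr0n// ler_nat; lia.
Qed.

End Subsequence.

(** * Local boundedness and normality *)

Section Montel.
Context {R : realType} {k : nat} {n : 'I_k -> nat} (q : forall i, posreg R (n i)).
Local Notation rW r := (scaled_model q r).
Implicit Types (F : multiword n -> R[i]) (G : set (multiword n -> R[i])).

(** Where the expansion does not converge, the value is the zero operator. *)
Lemma free_eval_bounded (H : hilbertType R) F (X : forall i, 'I_(n i) -> H -> H) :
  bounded_op (free_eval F X).
Proof.
rewrite /free_eval; case: xgetP => [T _ [] //|_]; exact: bounded_op0.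
Qed.

Lemma Hol_converges_to F r : 0 <= r < 1 -> Hol q F ->
  converges_to F (rW r) (free_eval F (rW r)).
Proof.
move=> r01 /(_ _ _ (scaled_model_polydomain q r01)) exT.
exact: (@xgetPex _ (fun=> 0) [set T | converges_to F (rW r) T] exT).
Qed.

Lemma normal_locally_bounded G : normal_set q G -> locally_bounded q G.
Proof.
move=> GN r r01; apply: contrapT => GnB.
have large m : exists F, G F /\ m%:R < opnorm (free_eval F (rW r)).
  apply: contrapT => noF; apply: GnB; exists m.+1%:R => [|F GF]; first exact: ltr0Sn.
  rewrite (@le_trans _ _ m%:R) ?ler_nat// leNgt; apply/negP => mF.
  by apply: noF; exists F.
have /choice[g gP] := large.
have [phi phi_lt [F _ /(_ r r01) /cvgrPdist_le /(_ 1 ltr01)]] := GN g (fun m => (gP m).1).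
move=> [N _ Ncvg].
have phi_ge l : (l <= phi l)%N.
  by elim: l => // l /leq_ltn_trans; apply; exact: phi_lt.
have bF := free_eval_bounded F (rW r).
have [m mF] : exists m : nat, opnorm (free_eval F (rW r)) + 1 < m%:R.
  exists (Num.bound (opnorm (free_eval F (rW r)) + 1)).
  by apply: archi_boundP; rewrite addr_ge0// opnorm_ge0.
pose l := maxn N m; have bg := free_eval_bounded (g (phi l)) (rW r).
have := Ncvg l (leq_maxl N m); rewrite /= sub0r normrN => /(le_trans (ler_norm _)) dist1.
have := (gP (phi l)).2; rewrite ltNge => /negP; apply.
apply: (@le_trans _ _ m%:R); last first.
  by rewrite ler_nat (leq_trans (leq_maxr N m))// phi_ge.
apply: ltW; apply: le_lt_trans mF; apply: opnorm_le.
  by rewrite addr_ge0// opnorm_ge0.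
move=> x; rewrite -(subrK (free_eval F (rW r) x) (free_eval (g (phi l)) _ x)).
rewrite (le_trans (nrmD _ _))// addrC mulrDl lerD ?nrm_opnorm//.
rewrite (le_trans (nrm_opnorm _ (bounded_opD bg (bounded_opN bF))))//.
by rewrite ler_wpM2r ?nrm_ge0.
Qed.

Lemma energyB_le F F' p :
  energy q (F - F') p <= 2 * energy q F p + 2 * energy q F' p.
Proof.
rewrite /energy !mulr_sumr -big_split; apply: ler_sum => w _ /=.
rewrite !mulrA -mulrDl ler_wpM2r ?invr_ge0 ?(ltW (mweight_gt0 _ _))//.
by rewrite !fctE (le_trans (sqabsD_le _ _))// !sqabs_nrm nrmN.
Qed.

Lemma energy_growthB F F' s M M' : 0 < s -> energy_growth q F s M ->
  energy_growth q F' s M' -> energy_growth q (F - F') s (2 * M + 2 * M').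
Proof.
move=> s0 FM FM' p; apply: (le_trans (ler_wpM2r _ (energyB_le F F' p))).
  by rewrite exprn_ge0// ltW.
by rewrite mulrDl -!mulrA lerD// ler_wpM2l.
Qed.

Lemma locally_bounded_energy G s : G `<=` Hol q -> locally_bounded q G ->
  0 < s < 1 -> exists M, forall F, G F -> energy_growth q F s M.
Proof.
move=> GHol GB /andP[s0 s1]; have s01 : 0 <= s < 1 by rewrite ltW.
have [M M0 GM] := GB s s01; exists (M ^+ 2) => F GF p.
have FT := Hol_converges_to s01 (GHol F GF).
apply: le_trans (energy_le_opnorm p FT) _.
by rewrite ler_pXn2r ?nnegrE ?(ltW M0) ?opnorm_ge0 ?GM//; case: FT.
Qed.

(** A coefficient contributes one term to a sum of nonnegative terms. *)
Lemma energy_growth_coef F s M w : 0 < s -> energy_growth q F s M ->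
  nrm (F w) <= Num.sqrt (M * mweight q w / s ^+ (2 * \sum_i size (w i))).
Proof.
move=> s0 FM; pose p : {ffun 'I_k -> nat} := [ffun i => size (w i)].
have wp : w \in multidegree_seq p.
  by rewrite mem_multidegree_seq; apply/asboolP => i; rewrite ffunE.
have -> : (\sum_i size (w i))%N = total_degree p.
  by apply: eq_bigr => i _; rewrite ffunE.
rewrite -[nrm _]ger0_norm ?nrm_ge0// -sqrtr_sqr ler_wsqrtr// -sqabs_nrm.
rewrite ler_pdivlMr ?exprn_gt0// -ler_pdivrMr ?mweight_gt0//.
apply: le_trans (FM p); rewrite mulrAC ler_wpM2r ?exprn_ge0 ?(ltW s0)//.
rewrite /energy (perm_big _ (perm_to_rem wp))/= big_cons lerDl.
by apply: sumr_ge0 => v _; rewrite divr_ge0 ?sqabs_ge0// ltW// mweight_gt0.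
Qed.

Lemma energy_cvg0 (g : nat -> multiword n -> R[i]) F p :
  (forall w, nrm (g l w - F w) @[l --> \oo] --> (0 : R)) ->
  energy q (g l - F) p @[l --> \oo] --> (0 : R).
Proof.
move=> gF; have : energy q (g l - F) p @[l --> \oo] -->
    \sum_(w <- @multidegree_seq k n p) (0 : R).
  apply: cvg_big => [|w _]; first exact: add_continuous.
  have : nrm (g l w - F w) * nrm (g l w - F w) @[l --> \oo] --> (0 * 0 : R).
    exact: cvgM.
  move=> /(cvgMr_tmp (b := (mweight q w)^-1)); rewrite mul0r mul0r.
  by under eq_fun do rewrite -expr2 -sqabs_nrm.
by rewrite big1.
Qed.

Lemma locally_bounded_normal G : G `<=` Hol q -> locally_bounded q G -> normal_set q G.
Proof.
move=> GHol GB g gG.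
have half01 : 0 < (2^-1 : R) < 1 by rewrite invr_gt0 ltr0n invf_lt1 ?ltr1n.
have [M0 GM0] := locally_bounded_energy GHol GB half01.
have [|phi phi_lt [F gF]] := @diagonal_subsequence R
    ({dffun forall i, seq 'I_(n i)} : countType) g.
  move=> w; eexists => m; have /andP[h0 _] := half01.
  exact: energy_growth_coef h0 (GM0 _ (gG m)).
have Ecvg p := @energy_cvg0 (fun l => g (phi l)) F p gF.
have gM s : 0 < s < 1 -> exists M, forall l, energy_growth q (g (phi l)) s M.
  by move=> /(locally_bounded_energy GHol GB)[M GM]; exists M => l; exact: GM.
have FM s : 0 < s < 1 -> exists M, energy_growth q F s M.
  move=> s01; have [M gsM] := gM s s01; have /andP[s0 s1] := s01.
  exists (2 * 1 + 2 * M) => p.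
  have /cvgrPdist_le /(_ 1 ltr01) [N _ /(_ N (leqnn N))] := Ecvg p.
  rewrite /= sub0r normrN ger0_norm ?energy_ge0// => E1.
  have -> : F = g (phi N) - (g (phi N) - F) by rewrite subKr.
  apply: (le_trans (ler_wpM2r _ (energyB_le _ _ p))).
    by rewrite exprn_ge0// ltW.
  rewrite mulrDl addrC -!mulrA lerD// ler_wpM2l//.
    apply: mulr_ile1 => //; first exact: energy_ge0.
      by rewrite exprn_ge0// ltW.
    by rewrite exprn_ile1// ltW.
  exact: gsM.
have HolF : Hol q F.
  by move=> H X DX; exact: (energy_growth_converges DX FM).
exists phi => //; exists F => // r r01.
apply: (dominated_evaluation (scaled_model_polydomain q r01)) => //.
- by move=> l; exact: (Hol_converges_to r01 (GHol _ (gG (phi l)))).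
- exact: Hol_converges_to.
- exact: Ecvg.
- move=> s s01; have [M gsM] := gM s s01; have [M' FM'] := FM s s01.
  exists (2 * M + 2 * M') => l; apply: energy_growthB => //.
  by case/andP: s01.
Qed.

End Montel.

Theorem theorem4p2 (R : realType) (k : nat) (k_gt0 : (0 < k)%N)
    (n : 'I_k -> nat) (n_gt0 : forall i, (0 < n i)%N)
    (q : forall i, posreg R (n i))
    (G : set (multiword n -> R[i])) (GHol : G `<=` Hol q) :
  locally_bounded q G <-> normal_set q G.
Proof.
split; first exact: locally_bounded_normal.
exact: normal_locally_bounded.
Qed.
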